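(* With the mesh, data and operators of the context, consider the second-order cone program $$\min_{\bm\varphi,\bm q,\bm z}\big\{\langle\bm\varphi,\bm c\rangle_{\mathrm c,V}\ \big|\ \mathcal A\bm\varphi=\bm q,\ \mathcal B\mathcal F\bm q+\bm d=\bm z,\ \mathcal T\bm z\in\mathbb Q\big\}$$ and its KKT system, in the unknowns $\bm\varphi\in\mathbb{R}^{\mathbf V^{\mathrm c}}$, $\bm q\in\mathbb{R}^{\mathbf V^{\mathrm{st}}}\times\mathbb{R}^{3\times\mathbf T^{\mathrm c}}$, $\bm z\in\mathbb{R}^{\mathbf V^{\mathrm{st}}}\times(\mathbb{R}^{3\times\mathbf T^{\mathrm{st}}})^6\times\mathbb{R}^{\mathbf V^{\mathrm{st}}}$, $\bm\alpha=(\bm\alpha_1;\bm\alpha_2)\in\mathbb{R}^{\mathbf V^{\mathrm{st}}}\times\mathbb{R}^{3\times\mathbf T^{\mathrm c}}$, $\bm\beta\in\mathbb{R}^{\mathbf V^{\mathrm{st}}}\times(\mathbb{R}^{3\times\mathbf T^{\mathrm{st}}})^6\times\mathbb{R}^{\mathbf V^{\mathrm{st}}}$: $$(\mathrm{KKT}_{\mathrm{soc}})\quad\begin{cases}\mathcal A\bm\varphi=\bm q,\quad \mathcal B\mathcal F\bm q+\bm d=\bm z,\\ \mathcal W_{\mathrm c,V}\bm c+\mathcal A^*(\mathcal W_{\mathrm{st},V}\bm\alpha_1;\mathcal W_{\mathrm c,T}\bm\alpha_2)=0,\\ (\mathcal W_{\mathrm{st},V}\bm\alpha_1;\mathcal W_{\mathrm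 c,T}\bm\alpha_2)+\mathcal F^*\mathcal B^*\,\mathrm{Diag}(\mathcal W_{\mathrm{st},V},\mathcal I_6\otimes\mathcal W_{\mathrm{st},T},\mathcal W_{\mathrm{st},V})\bm\beta=0,\\ \mathcal T\bm z\in\mathbb Q,\quad \mathrm{Diag}(\mathcal W_{\mathrm{st},V},\mathcal I_6\otimes\mathcal W_{\mathrm{st},T},\mathcal W_{\mathrm{st},V})\bm\beta\in\mathcal T^*\mathbb Q,\quad\langle\bm\beta,\bm z\rangle_z=0.\end{cases}$$ Then the solution set of $(\mathrm{KKT}_{\mathrm{soc}})$ is not empty. Moreover, for any solution $(\bm\varphi;\bm q;\bm z;\bm\alpha;\bm\beta)$ of $(\mathrm{KKT}_{\mathrm{soc}})$, the vector $(\bm\varphi;\bm q;\bm\lambda_0;\bar{\bm\lambda};\bm\lambda_q):=(\bm\varphi;\bm q;\bm\alpha_1;\bm\alpha_2;-\bm\alpha_1)$ is a solution of the system $$\begin{cases}\mathcal A\bm\varphi=\bm q\equiv(\bm A;\bm B),\quad \mathcal W_{\mathrm c,V}\bm c+\mathcal A^*(\mathcal W_{\mathrm{st},V}\bm\lambda_0;\mathcal W_{\mathrm c,T}\bar{\bm\lambda})=0,\quad \bm\lambda_0+\bm\lambda_q=0,\\ 0\le\bm\lambda_0\perp\bm A+\tfrac12\mathcal L_t\mathcal L_s^*(|||\bm B|||^2)\le0,\quad \bar{\bm\lambda}=\big((\mathcal L_s\mathcal L_t^*\bm\lambda_0)\otimes\bm 1_3\big)\odot\bm B,\end{cases}$$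 which is the KKT system of the discretized dual dynamic optimal transport problem $\min_{\bm\varphi,\bm q}\{\langle\bm\varphi,\bm c\rangle_{\mathrm c,V}\mid\mathcal A\bm\varphi=\bm q\equiv(\bm A;\bm B),\ \bm A+\tfrac12\mathcal L_t\mathcal L_s^*(|||\bm B|||^2)\le0\}$.
   Context: Mesh. $V=\{\bm v_1,\dots,\bm v_{|V|}\}\subset\mathbb{R}^3$ is a finite set of vertices and $T=\{\bm f_1,\dots,\bm f_{|T|}\}$ a finite set of nondegenerate closed triangles with vertices in $V$. Any two distinct triangles meet in the empty set, a common vertex or a common edge; every vertex belongs to at least one triangle; the mesh is connected (the union of the triangles is connected). $V_{\bm f}$ is the set of vertices of $\bm f$, $T_{\bm v}$ the set of triangles having $\bm v$ as a vertex, $|\bm f|$ the area of $\bm f$, $|\bm v|:=\frac13\sum_{\bm f\in T_{\bm v}}|\bm f|$. For each $\bm f\in T$ an ordering $\bm v_1^{\bm f},\bm v_2^{\bm f},\bm v_3^{\bm f}$ of its vertices is fixed, and $T_{\bm v,i}:=\{\bm f\in T_{\bm v}\mid\bm v_i^{\bm f}=\bm v\}$, $i=1,2,3$, with elements listed in order as $\bm f_1^{\bm v,i},\dots,\bm f_{|T_{\bm v,i}|}^{\bm v,i}$. Index sets. $N\ge1$ is an integer, $\mathcal G^{\mathrm c}=\{0,1,\dots,N\}$, $\mathcal G^{\mathrm{st}}=\{\frac12,\frac32,\dots,N-\frac12\}$, $\mathbf V^{\mathrm c}=\mathcal G^{\mathrm c}\times V$, $\mathbf V^{\mathrm{st}}=\mathcal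 G^{\mathrm{st}}\times V$, $\mathbf T^{\mathrm c}=\mathcal G^{\mathrm c}\times T$, $\mathbf T^{\mathrm{st}}=\mathcal G^{\mathrm{st}}\times T$, ordered lexicographically with time first. $\mathbb{R}^{3\times\mathbf T^{\mathrm c}}$, $\mathbb{R}^{3\times\mathbf T^{\mathrm{st}}}$ are the spaces of families of vectors in $\mathbb{R}^3$ indexed by $\mathbf T^{\mathrm c}$, $\mathbf T^{\mathrm{st}}$. $(\cdot;\cdot)$ is vertical stacking, $\mathrm{Diag}$ a block-diagonal matrix with (possibly rectangular) blocks, $\mathcal I_n$ the identity, $\otimes$, $\odot$ the Kronecker and Hadamard products, vector inequalities are componentwise, $\perp$ means Euclidean inner product zero, $\bm 0_n,\bm 1_n$ are the all-zeros and all-ones vectors. $\mathcal A^*,\mathcal F^*,\mathcal B^*,\mathcal T^*$ are Euclidean adjoints (transposes). Discrete gradient. $\mathcal A=(\mathcal A_t;\mathcal A_s):\mathbb{R}^{\mathbf V^{\mathrm c}}\to\mathbb{R}^{\mathbf V^{\mathrm{st}}}\times\mathbb{R}^{3\times\mathbf T^{\mathrm c}}$ with $(\mathcal A_t\bm\varphi)_{k,\bm v}=N(\varphi_{k+\frac12,\bm v}-\varphi_{k-\frac12,\bm v})$ and $(\mathcal A_s\bm\varphi)_{k,\bm f}=\sum_{i=1}^3\varphi_{k,\bm v_i^{\bm f}}\nabla h_{\bm v_i^{\bm f}}$, where on the triangle $\bm f$ $$(\nabla h_{\bm v_1^{\bm f}},\nabla h_{\bm v_2^{\bm f}},\nabla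 h_{\bm v_3^{\bm f}})=J_{\bm f}(J_{\bm f}^\top J_{\bm f})^{-1}\begin{pmatrix}-1&1&0\\-1&0&1\end{pmatrix},\quad J_{\bm f}=(\bm v_2^{\bm f}-\bm v_1^{\bm f},\ \bm v_3^{\bm f}-\bm v_1^{\bm f}).$$ Weights. $\mathcal W_{\mathrm c,V}$, $\mathcal W_{\mathrm{st},V}$ multiply the $(k,\bm v)$ component by $|\bm v|/N$ on $\mathbb{R}^{\mathbf V^{\mathrm c}}$, $\mathbb{R}^{\mathbf V^{\mathrm{st}}}$; $\mathcal W_{\mathrm c,T}$, $\mathcal W_{\mathrm{st},T}$ multiply the $(k,\bm f)$ component by $|\bm f|/N$ on $\mathbb{R}^{3\times\mathbf T^{\mathrm c}}$, $\mathbb{R}^{3\times\mathbf T^{\mathrm{st}}}$. $\langle\bm x,\hat{\bm x}\rangle_{\mathrm c,V}:=\langle\bm x,\mathcal W_{\mathrm c,V}\hat{\bm x}\rangle$ and $\langle\bm\beta,\bm\beta'\rangle_z:=\langle\bm\beta,\mathrm{Diag}(\mathcal W_{\mathrm{st},V},\mathcal I_6\otimes\mathcal W_{\mathrm{st},T},\mathcal W_{\mathrm{st},V})\bm\beta'\rangle$. Given $\bm\mu_0,\bm\mu_N\in\{\bm\mu\in\mathbb{R}^{|V|}_+\mid\sum_{\bm v}|\bm v|\mu_{\bm v}=1\}$, the vector $\bm c\in\mathbb{R}^{\mathbf V^{\mathrm c}}$ is determined by $\langle\bm\varphi,\bm c\rangle_{\mathrm c,V}=\sum_{\bm v}|\bm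 v|\varphi_{0,\bm v}\mu_{0,\bm v}-\sum_{\bm v}|\bm v|\varphi_{N,\bm v}\mu_{N,\bm v}$ for all $\bm\varphi$. Interpolation. $(\mathcal L_t\bm\varphi)_{k,\bm v}=\frac12(\varphi_{k+\frac12,\bm v}+\varphi_{k-\frac12,\bm v})$ for $k\in\mathcal G^{\mathrm{st}}$; $(\mathcal L_s\bm\varphi)_{k,\bm f}=\frac13\sum_{\bm v\in V_{\bm f}}\varphi_{k,\bm v}$ for $k\in\mathcal G^{\mathrm c}$; their adjoints with respect to the weighted inner products are $(\mathcal L_t^*\bm\psi)_{k,\bm v}=\frac12(\psi_{k-\frac12,\bm v}+\psi_{k+\frac12,\bm v})$ for $k\in\mathcal G^{\mathrm c}$ (terms with time index outside $\mathcal G^{\mathrm{st}}$ are zero) and $(\mathcal L_s^*\bm y)_{k,\bm v}=\frac1{3|\bm v|}\sum_{\bm f\in T_{\bm v}}|\bm f|y_{k,\bm f}$. $|||\bm B|||^2\in\mathbb{R}^{\mathbf T^{\mathrm c}}$ has components $\|\bm B_{k,\bm f}\|^2$. SOCP operators. $\mathcal F(\bm A;\bm B)=(\bm A;\bm D_1^-;\bm D_2^-;\bm D_3^-;\bm D_1^+;\bm D_2^+;\bm D_3^+)$ with $\bm D_i^\pm\in\mathbb{R}^{3\times\mathbf T^{\mathrm{st}}}$, $(\bm D_i^\pm)_{k,\bm f}=\bm B_{k\pm\frac12,\bm f}$, $i=1,2,3$. $\mathcal B(\bm x;\bm y)=(-\bm x;\frac{\sqrt3}3\bm y;\bm x)$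 for $\bm x\in\mathbb{R}^{\mathbf V^{\mathrm{st}}}$, $\bm y\in(\mathbb{R}^{3\times\mathbf T^{\mathrm{st}}})^6$. $\bm d=(\bm 1_{|\mathbf V^{\mathrm{st}}|};\bm 0_{18|\mathbf T^{\mathrm{st}}|};\bm 1_{|\mathbf V^{\mathrm{st}}|})$. For $(k,\bm v)\in\mathbf V^{\mathrm{st}}$, $\mathcal T_i^{k,\bm v}\bm D:=\big(\sqrt{|\bm f_1^{\bm v,i}|/|\bm v|}\,\bm D_{k,\bm f_1^{\bm v,i}};\dots;\sqrt{|\bm f^{\bm v,i}_{|T_{\bm v,i}|}|/|\bm v|}\,\bm D_{k,\bm f^{\bm v,i}_{|T_{\bm v,i}|}}\big)\in\mathbb{R}^{3|T_{\bm v,i}|}$ for $\bm D\in\mathbb{R}^{3\times\mathbf T^{\mathrm{st}}}$; $\mathcal T^{k,\bm v}:=\mathrm{Diag}(\bm e_{k,\bm v}^\top,\mathcal T_1^{k,\bm v},\mathcal T_2^{k,\bm v},\mathcal T_3^{k,\bm v},\mathcal T_1^{k,\bm v},\mathcal T_2^{k,\bm v},\mathcal T_3^{k,\bm v},\bm e_{k,\bm v}^\top)$, with $\bm e_{k,\bm v}\in\mathbb{R}^{\mathbf V^{\mathrm{st}}}$ the unit vector at $(k,\bm v)$; $\mathcal T\bm z$ is the stacking of $\mathcal T^{k,\bm v}\bm z$ over $(k,\bm v)\in\mathbf V^{\mathrm{st}}$ in lexicographic order (time first). $\mathbb Q:=\prod_{(k,\bm v)\in\mathbf V^{\mathrm{st}}}\mathbb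 K^{k,\bm v}_{\mathrm{soc}}$ (same order), where $\mathbb K^{k,\bm v}_{\mathrm{soc}}=\{\bm y=(y_0;\bar{\bm y})\in\mathbb{R}^{2+6|T_{\bm v}|}\mid y_0\ge\|\bar{\bm y}\|\}$, $y_0$ being the first component and $\bar{\bm y}$ the remaining ones. *)

(* Defs.v *)
From HB Require Import structures.
From mathcomp Require Import all_boot all_order all_algebra.
From mathcomp Require Import all_classical all_reals all_analysis.
Import Order.TTheory GRing.Theory Num.Theory.
Import numFieldNormedType.Exports.

Set Implicit Arguments.
Unset Strict Implicit.
Unset Printing Implicit Defensive.

Local Open Scope classical_set_scope.
Local Open Scope ring_scope.

(** * Finite-dimensional Euclidean spaces *)

(* A Euclidean space is R^I for a finite index type I.  A product of spaces is
   indexed by the sum of the index types, and a family of vectors of R^3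
   indexed by I is indexed by I * 'I_3. *)
Definition vec (R : realType) (I : finType) := {ffun I -> R}.

Section Euclidean.
Variable R : realType.
Implicit Types I J : finType.

Definition dotp I (x y : vec R I) : R := \sum_i x i * y i.

Definition stack I J (x : vec R I) (y : vec R J) : vec R (I + J)%type :=
  [ffun s => match s with inl i => x i | inr j => y j end].
Definition topv I J (x : vec R (I + J)%type) : vec R I := [ffun i => x (inl i)].
Definition botv I J (x : vec R (I + J)%type) : vec R J := [ffun j => x (inr j)].

Definition unitv I (i : I) : vec R I := [ffun j => (j == i)%:R].

(* The transpose: row i of the result is column i of the matrix of L.  It is
   the Euclidean adjoint when L is linear. *)
Definition adj I J (L : vec R I -> vec R J) (y : vec R J) : vec R I :=
  [ffun i => dotp (L (unitv i)) y].

Definition line I (x d : vec R I) (t : R) : vec R I := [ffun i => x i + t * d i].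

End Euclidean.

(** * Triangle meshes *)

(* [tri f 0], [tri f 1], [tri f 2] is the fixed ordering of the vertices of f. *)
Record mesh_data (R : realType) := MeshData {
  nV : nat;
  nT : nat;
  pos : 'I_nV -> 'cV[R]_3;
  tri : 'I_nT -> 'I_3 -> 'I_nV
}.

Section Mesh.
Variables (R : realType) (M : mesh_data R).
Implicit Types (v : 'I_(nV M)) (f : 'I_(nT M)).

Definition verts f : {set 'I_(nV M)} := [set tri f i | i : 'I_3]%SET.

Definition star v : {set 'I_(nT M)} := [set f | v \in verts f]%SET.

Definition starn v (i : 'I_3) : {set 'I_(nT M)} :=
  [set f in star v | tri f i == v]%SET.

(* J_f = (v_2 - v_1, v_3 - v_1) *)
Definition jac f : 'M[R]_(3, 2) :=
  \matrix_(a < 3, j < 2) (pos (tri f (lift ord0 j)) - pos (tri f ord0)) a ord0.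

(* Half of the area of the parallelogram spanned by the columns of J_f, that
   area being the square root of their Gram determinant. *)
Definition farea f : R := 2^-1 * Num.sqrt (\det ((jac f)^T *m jac f)).

Definition varea v : R := 3^-1 * \sum_(f in star v) farea f.

Definition hull (S : {set 'I_(nV M)}) : set 'cV[R]_3 :=
  [set x | exists a : 'I_(nV M) -> R,
     [/\ forall v, 0 <= a v, \sum_(v in S) a v = 1
       & x = \sum_(v in S) a v *: pos v]].

Definition triangle f : set 'cV[R]_3 := hull (verts f).

Definition meet_properly f g : Prop :=
  [\/ triangle f `&` triangle g = set0,
      exists2 v, v \in verts f :&: verts g
               & triangle f `&` triangle g = [set pos v]
    | exists u v, [/\ u != v, u \in verts f :&: verts g,
                      v \in verts f :&: verts g
                    & triangle f `&` triangle g = hull [set u; v]%SET]].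

Definition is_mesh : Prop :=
  [/\ injective (@pos R M),
      forall f, \rank (jac f) = 2%N,
      forall f g, f != g -> meet_properly f g,
      forall v, exists f, v \in verts f
    & connected (\bigcup_f triangle f)].

(* Column i is the gradient of the hat function of the i-th vertex of f. *)
Definition gradh f : 'M[R]_3 :=
  jac f *m invmx ((jac f)^T *m jac f) *m
  \matrix_(i < 2, j < 3)
     nth 0 (nth [::] [:: [:: -1; 1; 0]; [:: -1; 0; 1]] i) j.

End Mesh.

(** * Space-time operators *)

Section Operators.
Variables (R : realType) (M : mesh_data R) (N : nat).

(* The integer times are 'I_N.+1; k : 'I_N stands for the staggered time
   k + 1/2, whose neighbours are [tprev k] = k and [tnext k] = k + 1. *)
Definition Vc := ('I_N.+1 * 'I_(nV M))%type.
Definition Vst := ('I_N * 'I_(nV M))%type.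
Definition Tc := ('I_N.+1 * 'I_(nT M))%type.
Definition Tst := ('I_N * 'I_(nT M))%type.
Definition Tc3 := (Tc * 'I_3)%type.
Definition Tst3 := (Tst * 'I_3)%type.

Definition tprev (k : 'I_N) : 'I_N.+1 := widen_ord (leqnSn N) k.
Definition tnext (k : 'I_N) : 'I_N.+1 := lift ord0 k.

(* (D_1^-, D_2^-, D_3^-, D_1^+, D_2^+, D_3^+): [(s, i)] is the index of D_{i+1}
   with exponent - if s = false and + if s = true. *)
Definition six := (bool * 'I_3)%type.

Definition Qi := (Vst + Tc3)%type.
Definition Di := (six * Tst3)%type.
Definition Fi := (Vst + Di)%type.
Definition Zi := (Vst + (Di + Vst))%type.

(** Discrete gradient *)

Definition At (phi : vec R Vc) : vec R Vst :=
  [ffun p => N%:R * (phi (tnext p.1, p.2) - phi (tprev p.1, p.2))].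
Definition As (phi : vec R Vc) : vec R Tc3 :=
  [ffun p => \sum_(i < 3)
     phi (p.1.1, tri p.1.2 i) * gradh p.1.2 p.2 i].
Definition opA (phi : vec R Vc) : vec R Qi := stack (At phi) (As phi).

(** Weights *)

Definition WcV (x : vec R Vc) : vec R Vc := [ffun p => varea p.2 / N%:R * x p].
Definition WstV (x : vec R Vst) : vec R Vst :=
  [ffun p => varea p.2 / N%:R * x p].
Definition WcT (x : vec R Tc3) : vec R Tc3 :=
  [ffun p => farea p.1.2 / N%:R * x p].
Definition WstT (x : vec R Tst3) : vec R Tst3 :=
  [ffun p => farea p.1.2 / N%:R * x p].

Definition Wq (x : vec R Qi) : vec R Qi :=
  stack (WstV (topv x)) (WcT (botv x)).

Definition WD (y : vec R Di) : vec R Di :=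
  [ffun m => WstT [ffun p => y (m.1, p)] m.2].
Definition Wz (z : vec R Zi) : vec R Zi :=
  stack (WstV (topv z)) (stack (WD (topv (botv z))) (WstV (botv (botv z)))).

Definition dot_cV (x y : vec R Vc) : R := dotp x (WcV y).
Definition dot_z (x y : vec R Zi) : R := dotp x (Wz y).

(** Interpolation *)

Definition Lt (phi : vec R Vc) : vec R Vst :=
  [ffun p => 2^-1 * (phi (tnext p.1, p.2) + phi (tprev p.1, p.2))].
Definition Ls (phi : vec R Vc) : vec R Tc :=
  [ffun p => 3^-1 * \sum_(v in verts p.2) phi (p.1, v)].
(* Each inner sum has at most one term, and none if the staggered time it
   refers to is out of range. *)
Definition Lt_adj (psi : vec R Vst) : vec R Vc :=
  [ffun p => 2^-1 * (\sum_(k < N | tnext k == p.1) psi (k, p.2)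
                     + \sum_(k < N | tprev k == p.1) psi (k, p.2))].
Definition Ls_adj (y : vec R Tc) : vec R Vc :=
  [ffun p => (3 * varea p.2)^-1
             * \sum_(f in star p.2) farea f * y (p.1, f)].

Definition sqnorms (B : vec R Tc3) : vec R Tc :=
  [ffun p => \sum_(a < 3) B (p, a) ^+ 2].

(** Second-order cone operators *)

Definition opF (q : vec R Qi) : vec R Fi :=
  stack (topv q)
    [ffun m : Di =>
       let: ((s, _), ((k, f), a)) := m in
       botv q ((if s then tnext k else tprev k, f), a)].

Definition opB (w : vec R Fi) : vec R Zi :=
  stack (- topv w)
    (stack [ffun m => Num.sqrt 3 / 3 * botv w m] (topv w)).

Definition dvec : vec R Zi :=
  stack [ffun => 1] (stack [ffun => 0] [ffun => 1]).

(* The indices of a block in R^(2 + 6 |T_v|): the first component, then for each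
   sign one vector of R^3 per i and f in T_(v,i), then the last component. *)
Definition blk_tail (v : 'I_(nV M)) : finType :=
  ((bool * {x : 'I_3 * 'I_(nT M) | x.2 \in starn v x.1} * 'I_3) + unit)%type.
Definition blk (v : 'I_(nV M)) : finType := (unit + blk_tail v)%type.

Definition Yi : finType := {p : Vst & blk p.2}.

Definition opTkv (p : Vst) (z : vec R Zi) : vec R (blk p.2) :=
  [ffun b => match b with
    | inl _ => topv z p
    | inr (inl ((s, x), a)) =>
        let: (i, f) := val x in
        Num.sqrt (farea f / varea p.2)
        * topv (botv z) ((s, i), ((p.1, f), a))
    | inr (inr _) => botv (botv z) p
    end].

Definition opT (z : vec R Zi) : vec R Yi :=
  [ffun y => opTkv (tag y) z (tagged y)].

Definition Ksoc (p : Vst) (y : vec R (blk p.2)) : Prop :=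
  Num.sqrt (\sum_j y (inr j) ^+ 2) <= y (inl tt).

Definition coneQ (y : vec R Yi) : Prop :=
  forall p : Vst,
    Ksoc (p := p) [ffun b => y (Tagged (fun p : Vst => blk p.2) b)].

(** * KKT systems *)

(* KKT system of min <phi, c>_(c,V) subject to A phi = q, B F q + d = z and
   T z in Q. *)
Definition KKT_soc (c phi : vec R Vc) (q : vec R Qi) (z : vec R Zi)
    (alpha : vec R Qi) (beta : vec R Zi) : Prop :=
  [/\ opA phi = q /\ opB (opF q) + dvec = z,
      WcV c + adj opA (Wq alpha) = 0,
      Wq alpha + adj opF (adj opB (Wz beta)) = 0
    & [/\ coneQ (opT z),
          exists2 y, coneQ y & Wz beta = adj opT y
        & dot_z beta z = 0]].

(* The inequality constraint A + 1/2 L_t L_s^* (|||B|||^2) <= 0, q = (A; B) *)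
Definition dot_g (q : vec R Qi) : vec R Vst :=
  [ffun p => topv q p + 2^-1 * Lt (Ls_adj (sqnorms (botv q))) p].

Definition KKT_dot (c phi : vec R Vc) (q : vec R Qi)
    (lam0 : vec R Vst) (lamb : vec R Tc3) (lamq : vec R Vst) : Prop :=
  [/\ opA phi = q,
      WcV c + adj opA (Wq (stack lam0 lamb)) = 0,
      lam0 + lamq = 0,
      [/\ forall p, 0 <= lam0 p, dotp lam0 (dot_g q) = 0
        & forall p, dot_g q p <= 0]
    & lamb = [ffun p => Ls (Lt_adj lam0) p.1 * botv q p]].

(* Lagrangian of min <phi, c>_(c,V) subject to A phi = q and dot_g q <= 0, with
   multipliers lam and mu paired with the constraints through the weights. *)
Definition dot_lagrangian (c phi : vec R Vc) (q lam : vec R Qi)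
    (mu : vec R Vst) : R :=
  dot_cV phi c + dotp (opA phi - q) (Wq lam) + dotp (dot_g q) (WstV mu).

Definition dot_KKT_point (c phi : vec R Vc) (q lam : vec R Qi)
    (mu : vec R Vst) : Prop :=
  [/\ opA phi = q,
      forall p, dot_g q p <= 0,
      forall p, 0 <= mu p,
      forall p, mu p * dot_g q p = 0
    & forall (dphi : vec R Vc) (dq : vec R Qi),
        is_derive (0 : R) (1 : R)
          (fun t : R => dot_lagrangian c (line phi dphi t) (line q dq t) lam mu)
          0].

End Operators.

(* Main.v *)
Require Import Defs.
From HB Require Import structures.
From mathcomp Require Import all_boot all_order all_algebra.
From mathcomp Require Import all_classical all_reals all_analysis.
From mathcomp Require Import ring lra.
Import Order.TTheory GRing.Theory Num.Theory.
Import numFieldNormedType.Exports.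

Set Implicit Arguments.
Unset Strict Implicit.
Unset Printing Implicit Defensive.

Local Open Scope classical_set_scope.
Local Open Scope ring_scope.

(**
Write the constraint of the discretized transport problem as g(q) <= 0 with
g(q) = A + 1/2 Lt Ls^*(|||B|||^2), a function that is convex and quadratic in
q = (A; B).

The cone program encodes this same constraint.  Its block z_p = T^p(B F q + d)
at a staggered point p has the head 1 - A_p, the last entry 1 + A_p and between
them the rescaled vectors B around p, so that its Lorentz form is
(1 - A_p)^2 - (1 + A_p)^2 - 2 Lt Ls^*(|||B|||^2)_p = -4 g(q)_p
([lorentz_cone_block]), and z_p lies in the second-order cone iff g(q)_p <= 0
([in_soc_cone_block]).  Polarizing, the Lorentz product of z_p with the block of
a direction q' is -2 Dg(q)[q']_p ([lorentz_cone_dblock]).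

Let y be a dual variable of the cone constraint, so that y lies in the cone and
<y, T z> = 0.  Since every block z_p has a positive head, the block of y at p is
m_p >= 0 times the reflection (z_0; -zbar) of z_p, with m_p g(q)_p = 0
([soc_pair]).  The pairing of y with the block of q' is then -2 m_p Dg(q)[q']_p,
hence the equation for alpha says that alpha is the gradient in q of
<mu, g(q)>, where mu is 2 m divided by the weights.  That gradient is
(mu; (Ls Lt^* mu) B), because Lt and Lt^*, and Ls and Ls^*, are adjoint for the
weighted inner products ([stationary_q]).  These are the equations of the second
system ([KKT_dot_of_soc]), and the construction can be reversed
([KKT_soc_of_dot]), so that existence has to be shown for the second system
only.

Existence is an instance of a general statement on minimizing a linear form
under constraints that are a linear form plus a nonnegative combination of
squares of linear forms ([convex_program_KKT]).  It needs a Slater point, here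
phi = -t, and a recession cone that contains no direction of nonpositive cost
except the constants.  A recession direction has zero gradient on every
triangle, so that it only depends on time because the mesh is connected
([constant_on_mesh]); it is nonincreasing in time; and its cost is
phi_0 - phi_N because the two measures have mass 1.  If this is nonpositive,
phi is constant.  The general statement is proved by quadratic penalization: the
recession condition bounds the minimizers of the penalized functions, the Slater
point bounds the multipliers that they define, and the residual of the KKT
system, which tends to 0 along them, has a minimum on a compact set.

The second system is the KKT system of the transport problem because the
Lagrangian is a polynomial of degree 2 along every line
([dot_lagrangian_line]), whose linear coefficient is the sum of the residuals of
the two stationarity equations ([KKT_dot_lagrangian]).
*)

(** * Linear forms and continuity *)

Section LinearForms.
Variables (R : realType) (I : finType).
Implicit Types (L : vec R I -> R) (x d : vec R I).

Definition linear_form L := forall x d t, L (line x d t) = L x + t * L d.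

Lemma linear_form0 L : linear_form L -> L 0 = 0.
Proof.
move=> hL; have := hL 0 0 (-1).
have -> : line 0 0 (-1) = 0 :> vec R I.
  by apply/ffunP => i; rewrite !ffunE; ring.
by rewrite mulN1r subrr.
Qed.

Lemma linear_formD L x d : linear_form L -> L (x + d) = L x + L d.
Proof.
move=> hL; rewrite -[L d]mul1r -hL; congr L.
by apply/ffunP => i; rewrite !ffunE mul1r.
Qed.

Lemma linear_formE L x : linear_form L -> L x = \sum_i x i * L (unitv R i).
Proof.
move=> hL.
have {1}-> : x = \sum_i line 0 (unitv R i) (x i).
  apply/ffunP => j; rewrite sum_ffunE (bigD1 j)//= !ffunE eqxx mulr1 add0r.
  rewrite big1 ?addr0// => i ij; rewrite !ffunE eq_sym (negbTE ij) mulr0 addr0.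
  by [].
rewrite (big_morph L (fun x y => linear_formD x y hL) (linear_form0 hL)).
by apply: eq_bigr => i _; rewrite hL linear_form0// add0r.
Qed.

Lemma linear_form_sum (A : finType) (F : A -> vec R I -> R) :
  (forall k, linear_form (F k)) -> linear_form (fun x => \sum_k F k x).
Proof.
move=> hF x d t; rewrite mulr_sumr -big_split/=.
by apply: eq_bigr => k _; exact: hF.
Qed.

End LinearForms.

Section Continuity.
Variables (R : realType) (T : topologicalType).
Implicit Types f g : T -> R.

Lemma eq_continuous_fun f g : f =1 g -> continuous g -> continuous f.
Proof. by move=> /funext ->. Qed.

Lemma continuous_addf f g : continuous f -> continuous g ->
  continuous (fun x => f x + g x).
Proof. by move=> hf hg x; apply: cvgD; [exact: hf|exact: hg]. Qed.

Lemma continuous_mulf f g : continuous f -> continuous g ->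
  continuous (fun x => f x * g x).
Proof. by move=> hf hg x; apply: cvgM; [exact: hf|exact: hg]. Qed.

Lemma continuous_exprf f n : continuous f -> continuous (fun x => f x ^+ n).
Proof.
move=> hf; elim: n => [|n ih]; first exact: cst_continuous.
by under eq_fun do rewrite exprS; exact: continuous_mulf.
Qed.

Lemma continuous_sumf (A : finType) (F : A -> T -> R) :
  (forall i, continuous (F i)) -> continuous (fun x => \sum_i F i x).
Proof. by move=> hF; apply: continuous_big => // z; exact: add_continuous. Qed.

Lemma continuous_max0f f :
    continuous f -> continuous (fun x => Num.max (f x) 0).
Proof.
by move=> hf x; apply: continuous_max; [exact: hf|exact: cst_continuous].
Qed.
End Continuity.

Section LinearContinuous.
Variables (R : realType) (I : finType).

Lemma linear_form_continuous (T : topologicalType) (X : T -> vec R I)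
    (L : vec R I -> R) : linear_form L ->
  (forall i, continuous (fun y => X y i)) -> continuous (fun y => L (X y)).
Proof.
move=> hL hX.
apply: (@eq_continuous_fun _ _ _ (fun y => \sum_i X y i * L (unitv R i))).
  by move=> y; rewrite (linear_formE _ hL).
by apply: continuous_sumf => i; apply: continuous_mulf;
  [exact: hX|exact: cst_continuous].
Qed.

(** The product topology makes this an instance of the Tychonoff theorem. *)
Lemma box_compact (l u : I -> R) :
  compact [set x : {ptws I -> R} | forall i, l i <= x i <= u i].
Proof.
have := @tychonoff I (fun=> R) (fun i => `[l i, u i]%classic)
  (fun i => @segment_compact R _ _).
congr (compact _); apply/seteqP; split => x /= h i; have := h i;
  by rewrite /= in_itv.
Qed.
End LinearContinuous.

(** * KKT points of convex quadratic programs *)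

Lemma le0_of_bounded_ray (R : realType) (s C r0 : R) :
  (forall r, r0 <= r -> 0 < r -> r * s <= C) -> s <= 0.
Proof.
move=> h; rewrite leNgt; apply/negP => s0.
have := h (`|r0| + (`|C| + 1) / s).
have h1 : 0 < (`|C| + 1) / s by rewrite divr_gt0// ltr_wpDl.
have h2 := normr_ge0 r0; have h3 := ler_norm r0.
move=> /(_ _ _) H; have {H} : (`|r0| + (`|C| + 1) / s) * s <= C by apply: H; lra.
rewrite mulrDl divfK ?gt_eqF// => h4.
have h5 := ler_norm C; have h6 : 0 <= `|r0| * s by rewrite mulr_ge0// ltW.
by lra.
Qed.

(** The first-order condition at a minimum, in a form that needs a quadratic
    upper bound instead of a derivative. *)
Lemma slope_eq0 (R : realType) (G C : R) :
  (forall t, `|t| <= 1 -> 0 <= t * G + t ^+ 2 * C) -> G = 0.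
Proof.
move=> h; pose D := `|G| + `|C| + 1.
have hG := normr_ge0 G; have hC := normr_ge0 C; have hC' := ler_norm C.
have D0 : 0 < D by rewrite /D; lra.
have GD : `|G / D| <= 1.
  by rewrite normrM normfV (gtr0_norm D0) ler_pdivrMr// mul1r /D; lra.
(* With t = - G / D the hypothesis reads 0 <= (C - D) (G / D) ^ 2, and D > C. *)
have := h (- (G / D)); rewrite normrN => /(_ GD).
have -> : - (G / D) * G + (- (G / D)) ^+ 2 * C = (C - D) * (G / D) ^+ 2.
  by field; rewrite gt_eqF.
move=> h1; have h2 : 0 <= (G / D) ^+ 2 by exact: sqr_ge0.
have h3 : (G / D) ^+ 2 <= 0.
  rewrite leNgt; apply/negP => h3; have : (C - D) * (G / D) ^+ 2 < 0;
    last by lra.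
  by rewrite nmulr_rlt0// /D; lra.
have /eqP : (G / D) ^+ 2 = 0 by apply/eqP; rewrite eq_le h3 h2.
by rewrite sqrf_eq0 mulf_eq0 invr_eq0 (gt_eqF D0) orbF => /eqP.
Qed.

(** The squared positive part is convex, and its derivative 2 max(s, 0) is
    2-Lipschitz. *)
Lemma sqr_max0D_le (R : realType) (s h : R) :
  Num.max (s + h) 0 ^+ 2 <=
  Num.max s 0 ^+ 2 + 2 * Num.max s 0 * h + h ^+ 2.
Proof.
have [s0|s0] := lerP s 0; have [h0|h0] := lerP (s + h) 0; nra.
Qed.

Lemma sqr_max0_mono (R : realType) (s s' : R) : s <= s' ->
  Num.max s 0 ^+ 2 <= Num.max s' 0 ^+ 2.
Proof. by move=> ss'; have [?|?] := lerP s 0; have [?|?] := lerP s' 0; nra. Qed.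

Section ConvexProgram.
Variables (R : realType) (I J K : finType).
(* Minimize c under the constraints a_j + sum_k w_jk b_k^2 <= 0.  The form e
   pins down the direction u below, along which the program is invariant. *)
Variables (c e : vec R I -> R) (a : J -> vec R I -> R) (b : K -> vec R I -> R).
Variables (w : J -> K -> R).
Hypothesis hc : linear_form c.
Hypothesis he : linear_form e.
Hypothesis ha : forall j, linear_form (a j).
Hypothesis hb : forall k, linear_form (b k).
Hypothesis w_ge0 : forall j k, 0 <= w j k.

Definition quad j x := \sum_k w j k * b k x ^+ 2.
Definition constraint j x := a j x + quad j x.
Definition dconstraint j x d := a j d + 2 * \sum_k w j k * (b k x * b k d).

Definition penalty n x :=
  c x + n / 2 * (\sum_j Num.max (constraint j x) 0 ^+ 2) + 2^-1 * e x ^+ 2.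

Lemma quad_ge0 j x : 0 <= quad j x.
Proof. by apply: sumr_ge0 => k _; rewrite mulr_ge0 ?sqr_ge0. Qed.

Lemma constraint_line j x d t : constraint j (line x d t) =
  constraint j x + (t * dconstraint j x d + t ^+ 2 * quad j d).
Proof.
rewrite /constraint /dconstraint ha.
suff -> : quad j (line x d t) = quad j x +
   (2 * t * (\sum_k w j k * (b k x * b k d)) + t ^+ 2 * quad j d) by ring.
rewrite /quad !mulr_sumr -!big_split/=; apply: eq_bigr => k _.
by rewrite hb; ring.
Qed.

Lemma linear_form_dconstraint j x : linear_form (dconstraint j x).
Proof.
move=> d d' t; rewrite /dconstraint ha.
suff -> : \sum_k w j k * (b k x * b k (line d d' t)) =
   \sum_k w j k * (b k x * b k d) + t * \sum_k w j k * (b k x * b k d') by ring.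
rewrite mulr_sumr -big_split/=; apply: eq_bigr => k _.
by rewrite hb; ring.
Qed.

Let line0 (f : vec R I -> R) d r : linear_form f -> f (line 0 d r) = r * f d.
Proof. by move=> hf; rewrite hf linear_form0// add0r. Qed.

(** The penalty with parameter 1 on the ray r d, divided by r. By convexity it
    is nondecreasing in r. *)
Let ray_slope r d :=
    c d + r / 2 * ((\sum_j Num.max (a j d + r * quad j d) 0 ^+ 2) + e d ^+ 2).

Let penalty_slope r d : 0 < r -> penalty 1 (line 0 d r) = r * ray_slope r d.
Proof.
move=> r0; rewrite /penalty /ray_slope !line0//.
have -> : \sum_j Num.max (constraint j (line 0 d r)) 0 ^+ 2 =
   r ^+ 2 * \sum_j Num.max (a j d + r * quad j d) 0 ^+ 2.
  rewrite mulr_sumr; apply: eq_bigr => j _.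
  have -> : constraint j (line 0 d r) = r * (a j d + r * quad j d).
    rewrite /constraint line0// mulrDr; congr (_ + _).
    rewrite /quad !mulr_sumr; apply: eq_bigr => k _.
    by rewrite line0//; ring.
  by rewrite -exprMn maxr_pMr ?ltW// mulr0.
by field.
Qed.

Let slope_mono r r' d : 0 < r -> r <= r' -> ray_slope r d <= ray_slope r' d.
Proof.
move=> r0 rr'; rewrite /ray_slope lerD2l; apply: ler_pM.
- by rewrite divr_ge0// ltW.
- by apply: addr_ge0; [apply: sumr_ge0 => *|]; rewrite sqr_ge0.
- by rewrite ler_pM2r// invr_gt0.
rewrite lerD2r; apply: ler_sum => j _.
by apply: sqr_max0_mono; rewrite lerD2l ler_wpM2r// quad_ge0.
Qed.

Hypothesis recession : forall d, c d <= 0 -> (forall j, a j d <= 0) ->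
  (forall j, quad j d = 0) -> e d = 0 -> d = 0.

(** If the slope stays nonpositive along the ray, every term that the factor r
    multiplies has to vanish, and d is a recession direction of nonpositive
    cost. *)
Let slope_gt0 d : d != 0 -> exists2 r, 0 < r & 0 < ray_slope r d.
Proof.
move=> d0; apply: contrapT => hn.
have H r : 0 < r -> r * ((\sum_j Num.max (a j d + r * quad j d) 0 ^+ 2) +
    e d ^+ 2) <= - 2 * c d.
  move=> r0; have : ray_slope r d <= 0.
    by rewrite leNgt; apply/negP => ?; apply: hn; exists r.
  rewrite /ray_slope; lra.
have S0 r : 0 <= \sum_j Num.max (a j d + r * quad j d) 0 ^+ 2.
  by apply: sumr_ge0 => *; rewrite sqr_ge0.
have e0 : e d = 0.
  apply/eqP; rewrite -sqrf_eq0 eq_le sqr_ge0 andbT.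
  apply: (@le0_of_bounded_ray _ _ (- 2 * c d) 1) => r _ r0.
  by apply: le_trans (H r r0); rewrite ler_pM2l// lerDr.
have c0 : c d <= 0.
  have := H 1 ltr01; have := S0 1; have := sqr_ge0 (e d); lra.
have ray j r : 0 < r -> a j d + r * quad j d <= 0.
  move=> r0; suff : Num.max (a j d + r * quad j d) 0 ^+ 2 <= 0.
    move=> h; have /eqP : Num.max (a j d + r * quad j d) 0 ^+ 2 = 0.
      by apply/eqP; rewrite eq_le h sqr_ge0.
    rewrite sqrf_eq0 => /eqP <-.
    by rewrite le_max lexx.
  apply: (@le0_of_bounded_ray _ _ (- 2 * c d) r) => r' rr' r'0.
  apply: le_trans (H r' r'0); rewrite ler_pM2l//.
  apply: (@le_trans _ _ (Num.max (a j d + r' * quad j d) 0 ^+ 2)).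
    by apply: sqr_max0_mono; rewrite lerD2l ler_wpM2r// quad_ge0.
  rewrite (bigD1 j)//= -addrA lerDl addr_ge0 ?sqr_ge0//.
  by apply: sumr_ge0 => *; rewrite sqr_ge0.
have q0 j : quad j d = 0.
  apply/eqP; rewrite eq_le quad_ge0 andbT.
  apply: (@le0_of_bounded_ray _ _ (- a j d) 1) => r _ r0.
  by have := ray j r r0; lra.
move/eqP: d0; apply; apply: recession => // j.
by have := ray j 1 ltr01; rewrite q0 mulr0 addr0.
Qed.

(** Continuity in the coordinates, tested on families indexed by an arbitrary
    space, since it is used both for x and for pairs of x and multipliers. *)
Let vec_continuous (f : vec R I -> R) : Prop :=
  forall (T : topologicalType) (X : T -> vec R I),
    (forall i, continuous (fun y => X y i)) -> continuous (fun y => f (X y)).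

Let ptws_vec (x : {ptws I -> R}) : vec R I := [ffun i => x i].

Let ptws_vec_continuous i : continuous (fun x => ptws_vec x i).
Proof.
apply: (@eq_continuous_fun _ _ _ (fun x : {ptws I -> R} => x i)).
  by move=> x; rewrite ffunE.
exact: (@proj_continuous I (fun=> R) i).
Qed.

Let quad_continuous j : vec_continuous (quad j).
Proof.
move=> T X hX.
apply: continuous_sumf => k; apply: continuous_mulf;
  first exact: cst_continuous.
by apply: continuous_exprf; exact: linear_form_continuous.
Qed.

Let constraint_continuous j : vec_continuous (constraint j).
Proof. by move=> T X hX; apply: continuous_addf;
  [exact: linear_form_continuous|exact: (quad_continuous hX)]. Qed.

Let penalty_continuous n : vec_continuous (penalty n).
Proof.
move=> T X hX.
apply: continuous_addf; first apply: continuous_addf;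
  first exact: linear_form_continuous.
  apply: continuous_mulf; first exact: cst_continuous.
  by apply: continuous_sumf => j; apply: continuous_exprf;
    apply: continuous_max0f; exact: (constraint_continuous hX).
apply: continuous_mulf; first exact: cst_continuous.
by apply: continuous_exprf; exact: linear_form_continuous.
Qed.

Let slope_continuous r : vec_continuous (ray_slope r).
Proof.
move=> T X hX.
apply: continuous_addf; first exact: linear_form_continuous.
apply: continuous_mulf; first exact: cst_continuous.
apply: continuous_addf; last by apply: continuous_exprf;
  exact: linear_form_continuous.
apply: continuous_sumf => j; apply: continuous_exprf; apply: continuous_max0f.
apply: continuous_addf; first exact: linear_form_continuous.
by apply: continuous_mulf; [exact: cst_continuous|exact: (quad_continuous hX)].
Qed.

Let sqn (x : I -> R) := \sum_i x i ^+ 2.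

Let sqn_continuous : continuous (sqn : {ptws I -> R} -> R).
Proof.
by apply: continuous_sumf => i; apply: continuous_exprf;
  exact: (@proj_continuous I (fun=> R) i).
Qed.

Let sqn_coord x i : x i ^+ 2 <= sqn x.
Proof.
rewrite /sqn (bigD1 i)//= lerDl; apply: sumr_ge0 => *; exact: sqr_ge0.
Qed.

Let ball_compact (A : set {ptws I -> R}) r : 0 <= r -> closed A ->
  (forall x, A x -> sqn x <= r ^+ 2) -> compact A.
Proof.
move=> r0 cA Ar; apply: (subclosed_compact cA
    (@box_compact R I (fun=> - r) (fun=> r))).
move=> x /Ar h i /=; rewrite -ler_norml -(ler_pXn2r (n := 2))// ?nnegrE//.
by rewrite real_normK ?num_real//; apply: le_trans h; exact: sqn_coord.
Qed.

Let closed_level (f : {ptws I -> R} -> R) (D : set R) : continuous f ->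
  closed D -> closed (f @^-1` D).
Proof. by move=> cf cD; apply: closed_comp. Qed.

(** As the slope is nondecreasing in r, the radii that work in one direction
    also work in a neighbourhood of it; a single radius works on the compact
    unit sphere. *)
Lemma penalty_coercive : exists2 rho, 0 < rho &
  forall x : vec R I, rho ^+ 2 <= \sum_i x i ^+ 2 -> 0 < penalty 1 x.
Proof.
pose S : set {ptws I -> R} := [set x | sqn x = 1].
have cS : compact S.
  apply: (@ball_compact _ 1) => // [|x /= ->]; last by rewrite expr1n.
  exact: (closed_level sqn_continuous (closed_eq (y := 1))).
move/compact_near_coveringP : cS => /(_ R (pinfty_nbhs R)
  (fun r (x : {ptws I -> R}) => 0 < ray_slope r [ffun i => x i]) _) [].
  move=> x Sx.
  have : [ffun i => x i] != 0 :> vec R I.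
    apply/eqP => /ffunP h; move: Sx; rewrite /S/= /sqn big1 => [/eqP|i _].
      by rewrite eq_sym oner_eq0.
    by have := h i; rewrite !ffunE => ->; rewrite expr0n.
  move=> /slope_gt0[r r0 pr].
  exists ([set x' : {ptws I -> R} | 0 < ray_slope r [ffun i =>
    x' i]], [set r' | r < r']).
    split => /=; last by exists r; split => //; exact: num_real.
    exact: (cvgr_gt _ (@slope_continuous r _ _ ptws_vec_continuous x) _ pr).
  move=> [x' r'] /= [h1 h2]; apply: lt_le_trans h1 _; apply: slope_mono => //.
  exact: ltW.
move=> r0 [r0R h].
pose rho := `|r0| + 1.
have rho0 : 0 < rho by rewrite /rho ltr_wpDl.
exists rho => // x hx.
pose r := Num.sqrt (sqn x).
have rr : rho <= r.
  rewrite -(ler_pXn2r (n := 2))// ?nnegrE ?sqrtr_ge0 ?(ltW rho0)//.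
  by rewrite sqr_sqrtr//; apply: sumr_ge0 => *; exact: sqr_ge0.
have r_gt0 : 0 < r by exact: lt_le_trans rr.
have := h r; rewrite /=.
have -> : r0 < r.
  apply: lt_le_trans rr; rewrite /rho; have := ler_norm r0; lra.
move=> /(_ isT (fun i => x i / r)) /=.
have hS : S (fun i => x i / r).
  rewrite /S/= /sqn; under eq_bigr do rewrite expr_div_n.
  rewrite -mulr_suml -/(sqn x) /r sqr_sqrtr ?divff//.
    by rewrite gt_eqF// -sqrtr_gt0.
  by apply: sumr_ge0 => *; exact: sqr_ge0.
move=> /(_ hS) ph.
have -> : x = line 0 [ffun i => x i / r] r.
  by apply/ffunP => i; rewrite !ffunE add0r mulrC divfK// gt_eqF.
by rewrite penalty_slope// mulr_gt0.
Qed.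

Let penalty0 n : penalty n 0 = 0.
Proof.
rewrite /penalty !linear_form0// expr0n mulr0 addr0 add0r big1 ?mulr0// => j _.
rewrite /constraint /quad linear_form0// big1 => [|k _]; last first.
  by rewrite linear_form0// expr0n mulr0.
by rewrite addr0 maxxx expr0n.
Qed.

Let penalty_le n n' x : n <= n' -> penalty n x <= penalty n' x.
Proof.
move=> nn'; rewrite /penalty lerD2r lerD2l ler_wpM2r//; last first.
  by rewrite ler_pM2r// invr_gt0.
by apply: sumr_ge0 => *; exact: sqr_ge0.
Qed.

(** The penalty with parameter n >= 1 dominates the one with parameter 1, which
    is positive outside a ball, and it vanishes at 0: its minimum on the ball
    is global, and the ball does not depend on n. *)
Lemma penalty_minimizer : exists2 rho, 0 < rho &
  forall n, 1 <= n -> exists2 x : vec R I, \sum_i x i ^+ 2 <= rho ^+ 2 &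
    forall y, penalty n x <= penalty n y.
Proof.
have [rho rho0 hrho] := penalty_coercive; exists rho => // n n1.
pose B : set {ptws I -> R} := [set x | sqn x <= rho ^+ 2].
have cB : compact B.
  apply: (@ball_compact _ rho) => //; first exact: ltW.
  exact: (closed_level sqn_continuous (closed_le (y := rho ^+ 2))).
have B0 : B (fun=> 0).
  by rewrite /B/= /sqn big1 ?sqr_ge0// => i _; rewrite expr0n.
have [|x xB hx] := compact_EVT_min (ex_intro _ _ B0) cB
    (f := fun x => penalty n (ptws_vec x)).
  by apply: continuous_subspaceT;
    exact: (penalty_continuous ptws_vec_continuous).
rewrite inE in xB.
exists [ffun i => x i].
  by move: xB; rewrite /B/= /sqn;
    under [X in _ -> X <= _]eq_bigr do rewrite ffunE.
move=> y; have [yB|yB] := lerP (sqn y) (rho ^+ 2).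
  have := hx y; rewrite inE => /(_ yB).
  by congr (_ <= penalty n _); apply/ffunP => i; rewrite ffunE.
apply: (@le_trans _ _ 0).
  have := hx (fun=> 0); rewrite inE => /(_ B0).
  have -> : ptws_vec (fun=> 0) = 0 :> vec R I.
    by apply/ffunP => i; rewrite !ffunE.
  by rewrite penalty0.
apply: ltW; apply: lt_le_trans (penalty_le _ n1); apply: hrho; exact: ltW.
Qed.

(** [sqr_max0D_le] bounds the increase of the penalty along a line by its
    linear part plus a multiple of t ^ 2, for t in [-1, 1]. *)
Lemma penalty_stationary n x : 0 <= n ->
  (forall y, penalty n x <= penalty n y) ->
  forall d, c d + \sum_j n * Num.max (constraint j x) 0 * dconstraint j x d +
      e x * e d = 0.
Proof.
move=> n0 hx d.
apply: (@slope_eq0 _ _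
    (n / 2 * (\sum_j (2 * Num.max (constraint j x) 0 * quad j d
    + (`|dconstraint j x d| + quad j d) ^+ 2)) + 2^-1 * e d ^+ 2)) => t t1.
have := hx (line x d t); rewrite /penalty hc he.
suff : n / 2 * (\sum_j Num.max (constraint j (line x d t)) 0 ^+ 2) <=
  n / 2 * (\sum_j Num.max (constraint j x) 0 ^+ 2)
  + t * (\sum_j n * Num.max (constraint j x) 0 * dconstraint j x d)
  + t ^+ 2 * (n / 2 * (\sum_j (2 * Num.max (constraint j x) 0 * quad j d
    + (`|dconstraint j x d| + quad j d) ^+ 2))) by lra.
rewrite !mulr_sumr -!big_split/=; apply: ler_sum => j _.
rewrite constraint_line.
have := sqr_max0D_le (constraint j x) (t * dconstraint j x d +
    t ^+ 2 * quad j d).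
move: (Num.max (constraint j x) 0) (Num.max (_ + _) 0) => p p'.
set D := dconstraint j x d; set q := quad j d => H.
have q0 : 0 <= q by exact: quad_ge0.
have h2 : (D + t * q) ^+ 2 <= (`|D| + q) ^+ 2.
  rewrite -(real_normK (num_real (D + t * q))) ler_sqr ?nnegrE ?addr_ge0//.
  apply: (le_trans (ler_normD _ _)); rewrite lerD2l normrM (ger0_norm q0).
  by rewrite ler_piMl.
have h3 : t ^+ 2 * (D + t * q) ^+ 2 <= t ^+ 2 * (`|D| + q) ^+ 2.
  by rewrite ler_wpM2l// sqr_ge0.
have h4 : p' ^+ 2 <=
    p ^+ 2 + 2 * p * (t * D + t ^+ 2 * q) + t ^+ 2 * (`|D| + q) ^+ 2.
  apply: (le_trans H); rewrite lerD2l; apply: le_trans h3.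
  by rewrite le_eqVlt; apply/orP; left; apply/eqP; ring.
have h5 : n / 2 * p' ^+ 2 <= n / 2 *
    (p ^+ 2 + 2 * p * (t * D + t ^+ 2 * q) + t ^+ 2 * (`|D| + q) ^+ 2).
  by rewrite ler_wpM2l// divr_ge0.
apply: (le_trans h5).
by rewrite le_eqVlt; apply/orP; left; apply/eqP; field.
Qed.

Variables (u xs : vec R I).
Hypothesis cu : c u = 0.
Hypothesis au : forall j, a j u = 0.
Hypothesis bu : forall k, b k u = 0.
Hypothesis eu : e u = 1.
Hypothesis slater : forall j, constraint j xs < 0.

Lemma constraint_convex j x y :
  constraint j x + dconstraint j x (y - x) <= constraint j y.
Proof.
have -> : y = line x (y - x) 1 by apply/ffunP => i; rewrite !ffunE; ring.
rewrite constraint_line.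
have -> : line x (y - x) 1 - x = y - x.
  by apply/ffunP => i; rewrite !ffunE; ring.
have := quad_ge0 j (y - x); lra.
Qed.

(** The multipliers are n max(g_j, 0). Stationarity in the direction xs - x and
    convexity give sum_j lam_j (- g_j xs) <= c xs - c x, because lam_j g_j x >=
    0. The right-hand side is bounded on the ball, and each - g_j xs is
    positive. *)
Lemma multiplier_bounded : exists rho Lam, [/\ 0 < rho, 0 <= Lam &
  forall n, 1 <= n -> exists x : vec R I,
    [/\ \sum_i x i ^+ 2 <= rho ^+ 2,
        forall j, n * Num.max (constraint j x) 0 <= Lam
      & forall d, c d +
          \sum_j n * Num.max (constraint j x) 0 * dconstraint j x d = 0]].
Proof.
have [rho rho0 hrho] := penalty_minimizer.
pose Cb := \sum_i (rho ^+ 2 + 1) * `|c (unitv R i)|.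
have cb (x : vec R I) : \sum_i x i ^+ 2 <= rho ^+ 2 -> - c x <= Cb.
  move=> hx; rewrite (linear_formE _ hc) -sumrN; apply: ler_sum => i _.
  apply: (le_trans (ler_norm _)); rewrite normrN normrM ler_wpM2r//.
  have := le_trans (sqn_coord x i) hx; rewrite -(real_normK (num_real (x i))).
  have := sqr_ge0 (`|x i| - 1); have := sqr_ge0 (`|x i|); nra.
have Cb0 : 0 <= Cb.
  by apply: sumr_ge0 => i _; rewrite mulr_ge0// addr_ge0// sqr_ge0.
pose Cs := `|c xs| + Cb.
have Cs0 : 0 <= Cs by rewrite addr_ge0.
exists rho, (\sum_j Cs / - constraint j xs); split => //.
  by apply: sumr_ge0 => j _; rewrite divr_ge0// oppr_ge0 ltW.
move=> n n1; have [x xrho hx] := hrho n n1.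
have n0 : 0 <= n by lra.
have st := penalty_stationary n0 hx.
(* Along u only the penalty on e varies. *)
have ex0 : e x = 0.
  have := st u; rewrite cu eu mulr1 add0r big1 ?add0r// => j _.
  rewrite /dconstraint au big1 ?mulr0 ?addr0 ?mulr0// => k _.
  by rewrite bu !mulr0.
have {}st d :
    c d + \sum_j n * Num.max (constraint j x) 0 * dconstraint j x d = 0.
  by have := st d; rewrite ex0 mul0r addr0.
exists x; split => // j.
have lam0 i : 0 <= n * Num.max (constraint i x) 0.
  by rewrite mulr_ge0// le_max lexx orbT.
have S : \sum_j n * Num.max (constraint j x) 0 * - constraint j xs <= Cs.
  apply: (@le_trans _ _ (c (xs - x))).
    have -> : c (xs - x) =
        \sum_j n * Num.max (constraint j x) 0 * - dconstraint j x (xs - x).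
      have := st (xs - x); under [in X in _ -> _ = X]eq_bigr do rewrite mulrN.
      by rewrite sumrN => ?; lra.
    apply: ler_sum => i _.
    have := constraint_convex i x xs; have := lam0 i.
    have : 0 <= Num.max (constraint i x) 0 * constraint i x.
      by have [h|h] := lerP (constraint i x) 0;
        [rewrite mul0r|exact: mulr_ge0 (ltW h) (ltW h)].
    move: (Num.max _ _) => p hp hnp hcv.
    have h1 : 0 <= n * (p * constraint i x) by rewrite mulr_ge0.
    have h2 : n * p * (constraint i x + dconstraint i x (xs - x)) <=
        n * p * constraint i xs.
      by rewrite ler_wpM2l.
    by lra.
  have -> : xs - x = line xs x (-1) by apply/ffunP => i; rewrite !ffunE; ring.
  rewrite hc /Cs; have := cb x xrho; have := ler_norm (c xs); lra.
have gs : 0 < - constraint j xs by rewrite oppr_gt0.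
have T i : 0 <= n * Num.max (constraint i x) 0 * - constraint i xs.
  by rewrite mulr_ge0// oppr_ge0 ltW.
apply: (@le_trans _ _ (Cs / - constraint j xs)).
  rewrite ler_pdivlMr//; apply: le_trans S.
  by rewrite (bigD1 j)//= lerDl; apply: sumr_ge0 => *.
rewrite (bigD1 j)//= lerDl; apply: sumr_ge0 => i _.
by rewrite divr_ge0// oppr_ge0 ltW.
Qed.

(** The penalized minimizers and their multipliers satisfy the KKT system up to
    an error of order 1/n and stay in a compact box. The residual is
    continuous, so that it attains its minimum on the box, which is 0. *)
Lemma convex_program_KKT : exists (x : vec R I) (lam : J -> R),
  [/\ forall j, 0 <= lam j, forall j, constraint j x <= 0,
      forall j, lam j * constraint j x = 0
    & forall d, c d + \sum_j lam j * dconstraint j x d = 0].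
Proof.
have [rho [Lam [rho0 Lam0 H]]] := multiplier_bounded.
pose E : topologicalType := {ptws (I + J)%type -> R}.
pose X (y : E) : vec R I := [ffun i => y (inl i)].
pose L (y : E) (j : J) : R := y (inr j).
pose st (y : E) (d : vec R I) := c d + \sum_j L y j * dconstraint j (X y) d.
pose res (y : E) := \sum_i st y (unitv R i) ^+ 2
  + \sum_j Num.max (constraint j (X y)) 0 ^+ 2
  + \sum_j (L y j * constraint j (X y)) ^+ 2.
have cX (f : vec R I -> R) : vec_continuous f -> continuous (f \o X).
  apply=> i; apply: (@eq_continuous_fun _ _ _ (fun y : E => y (inl i))).
    by move=> y; rewrite ffunE.
  exact: (@proj_continuous (I + J)%type (fun=> R) (inl i)).
have cL j : continuous (fun y : E => L y j).
  exact: (@proj_continuous (I + J)%type (fun=> R) (inr j)).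
have cres : continuous res.
  apply: continuous_addf; first apply: continuous_addf.
  - apply: continuous_sumf => i; apply: continuous_exprf;
    apply: continuous_addf; first exact: cst_continuous.
    apply: continuous_sumf => j; apply: continuous_mulf => //.
    apply: (cX (fun x => dconstraint j x (unitv R i))) => T Y hY.
    apply: continuous_addf; first exact: cst_continuous.
    apply: continuous_mulf; first exact: cst_continuous.
    apply: continuous_sumf => k; apply: continuous_mulf;
      first exact: cst_continuous.
    by apply: continuous_mulf;
      [exact: linear_form_continuous|exact: cst_continuous].
  - apply: continuous_sumf => j; apply: continuous_exprf;
    apply: continuous_max0f.
    by apply: (cX (constraint j)); exact: constraint_continuous.
  - apply: continuous_sumf => j; apply: continuous_exprf;
    apply: continuous_mulf => //.
    by apply: (cX (constraint j)); exact: constraint_continuous.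
pose B : set E := [set y | forall s,
  (match s with inl _ => - rho | inr _ => 0 end)
  <= y s <= (match s with inl _ => rho | inr _ => Lam end)].
have cB : compact B by exact: box_compact.
have B0 : B (fun=> 0).
  by move=> [i|j] /=; rewrite ?lexx ?Lam0// oppr_le0 ltW.
have [|y yB hy] := compact_EVT_min (ex_intro _ _ B0) cB (f := res).
  exact: continuous_subspaceT.
rewrite inE in yB.
(* For the penalized minimizer, max(g_j, 0) = lam_j / n <= Lam / n. *)
have res_small n : 1 <= n -> n * res y <= \sum_(j : J) (Lam ^+ 2 + Lam ^+ 4).
  move=> n1; have n0 : 0 < n by lra.
  have [x [xr xl xs0]] := H n n1.
  pose y' : E := fun s => match s with inl i => x i
                        | inr j => n * Num.max (constraint j x) 0 end.
  have Xy' : X y' = x by apply/ffunP => i; rewrite ffunE.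
  have y'B : B y'.
    move=> [i|j] /=; last by rewrite xl mulr_ge0 ?le_max ?lexx ?orbT// ltW.
    rewrite -ler_norml -(ler_pXn2r (n := 2))// ?nnegrE ?(ltW rho0)//.
    rewrite real_normK ?num_real//; exact: (le_trans (sqn_coord x i) xr).
  apply: (@le_trans _ _ (n * res y')).
    by rewrite ler_pM2l//; apply: hy; rewrite inE.
  rewrite /res /st Xy' big1 => [|i _]; last by rewrite xs0 expr0n.
  rewrite add0r -big_split/= mulr_sumr; apply: ler_sum => j _.
  rewrite /L /y'.
  have -> : n * Num.max (constraint j x) 0 * constraint j x = n * Num.max
    (constraint j x) 0 ^+ 2.
    by have [h|h] := lerP (constraint j x) 0; ring.
  have := xl j.
  have : 0 <= Num.max (constraint j x) 0 by rewrite le_max lexx orbT.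
  move: (Num.max _ _) => p p0 pl.
  have h1 : (n * p) ^+ 2 <= Lam ^+ 2.
    by rewrite ler_sqr ?nnegrE ?mulr_ge0// ltW.
  have h2 : (n * p) ^+ 4 <= Lam ^+ 4.
    by rewrite ler_pXn2r ?nnegrE ?mulr_ge0// ltW.
  have h3 : n * p ^+ 2 <= (n * p) ^+ 2.
    rewrite exprMn ler_wpM2r ?sqr_ge0//; nra.
  have h4 : n * (n * p ^+ 2) ^+ 2 <= (n * p) ^+ 4.
    have -> : n * (n * p ^+ 2) ^+ 2 = n ^+ 3 * p ^+ 4 by ring.
    by rewrite exprMn ler_wpM2r ?exprn_ge0// ler_weXn2l.
  by rewrite mulrDr; lra.
have S1 : 0 <= \sum_i st y (unitv R i) ^+ 2.
  by apply: sumr_ge0 => *; exact: sqr_ge0.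
have S2 : 0 <= \sum_j Num.max (constraint j (X y)) 0 ^+ 2.
  by apply: sumr_ge0 => *; exact: sqr_ge0.
have S3 : 0 <= \sum_j (L y j * constraint j (X y)) ^+ 2.
  by apply: sumr_ge0 => *; exact: sqr_ge0.
have res0 : res y <= 0.
  apply: (@le0_of_bounded_ray _ _ (\sum_(j : J) (Lam ^+ 2 + Lam ^+ 4)) 1) =>
    r r1 _; exact: (res_small r r1).
have Z1 : \sum_i st y (unitv R i) ^+ 2 = 0 by move: res0; rewrite /res; lra.
have Z2 : \sum_j Num.max (constraint j (X y)) 0 ^+ 2 = 0.
  by move: res0; rewrite /res; lra.
have Z3 : \sum_j (L y j * constraint j (X y)) ^+ 2 = 0.
  by move: res0; rewrite /res; lra.
exists (X y), (L y); split.
- by move=> j; have /andP[] := yB (inr j).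
- move=> j; have /eqP := psumr_eq0P (fun j _ => sqr_ge0 _) Z2 (i := j) isT.
  by rewrite sqrf_eq0 => /eqP <-; rewrite le_max lexx.
- move=> j; have /eqP := psumr_eq0P (fun j _ => sqr_ge0 _) Z3 (i := j) isT.
  by rewrite sqrf_eq0 => /eqP.
have stl : linear_form (st y).
  move=> d d' t; rewrite /st hc.
  have -> : \sum_j L y j * dconstraint j (X y) (line d d' t) =
     \sum_j L y j * dconstraint j (X y) d +
         t * \sum_j L y j * dconstraint j (X y) d'.
    rewrite mulr_sumr -big_split/=; apply: eq_bigr => j _.
    by rewrite linear_form_dconstraint; ring.
  by ring.
move=> d; change (st y d = 0); rewrite (linear_formE _ stl) big1// => i _.
have /eqP := psumr_eq0P (fun j _ => sqr_ge0 _) Z1 (i := i) isT.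
by rewrite sqrf_eq0 => /eqP ->; rewrite mulr0.
Qed.
End ConvexProgram.

(** * Geometry of the mesh *)

Section MeshGeometry.
Variables (R : realType) (M : mesh_data R).
Hypothesis hM : is_mesh M.
Implicit Types (v : 'I_(nV M)) (f : 'I_(nT M)).

Let rank_jac f : \rank (jac f) = 2%N.
Proof. by case: hM. Qed.

Lemma jacT_inj f (u : 'rV[R]_2) : u *m (jac f)^T = 0 -> u = 0.
Proof.
have hJ : row_free (jac f)^T by rewrite /row_free mxrank_tr rank_jac.
by move/eqP; rewrite mulmx_free_eq0// => /eqP.
Qed.

Lemma rV_sqr_eq0 n (x : 'rV[R]_n) : x *m x^T = 0 -> x = 0.
Proof.
move/matrixP/(_ ord0 ord0); rewrite !mxE => h; apply/rowP => i.
have := psumr_eq0P (P := xpredT) _ h; move/(_ _)/(_ i isT).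
rewrite !mxE => /(_ _)/eqP; rewrite mulf_eq0 orbb => h'; apply/eqP/h'.
by move=> j _; rewrite !mxE -expr2 sqr_ge0.
Qed.

Lemma gram_unit f : (jac f)^T *m jac f \in unitmx.
Proof.
rewrite -row_free_unit; apply/inj_row_free => u hu.
apply: (@jacT_inj f); apply: rV_sqr_eq0.
by rewrite trmx_mul trmxK mulmxA -[_ *m jac f]mulmxA hu mul0mx.
Qed.

Lemma det_mx22 (A : 'M[R]_2) :
  \det A = A 0 0 * A 1 1 - A 0 1 * A 1 0.
Proof.
rewrite (expand_det_row _ 0) !big_ord_recl big_ord0 /cofactor !det_mx11 !mxE /=.
rewrite (_ : lift 0 0 = 1 :> 'I_2); last exact/val_inj.
rewrite (_ : lift 1 0 = 0 :> 'I_2); last exact/val_inj.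
by rewrite expr0 expr1; ring.
Qed.

(** The Gram determinant is a sum of three squares by Lagrange's identity, and
    it is nonzero by [gram_unit]. *)
Lemma farea_gt0 f : 0 < farea f.
Proof.
rewrite /farea mulr_gt0 ?invr_gt0// sqrtr_gt0 lt_def.
have := gram_unit f; rewrite unitmxE unitfE => -> /=.
rewrite det_mx22; move: (jac f) => A; rewrite !mxE !big_ord_recl !big_ord0 !mxE.
set l2 := lift ord0 (lift _ _).
move: (A 0 0) (A 0 1) (A (lift ord0 0) 0) (A (lift ord0 0) 1) (A l2 0) (A l2 1).
move=> a0 b0 a1 b1 a2 b2.
have := sqr_ge0 (a0 * b1 - a1 * b0); have := sqr_ge0 (a0 * b2 - a2 * b0).
have := sqr_ge0 (a1 * b2 - a2 * b1); lra.
Qed.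

(** If two vertices of f coincide, the combination of the columns of the
    Jacobian that represents their difference vanishes. *)
Lemma tri_inj f : injective (@tri R M f).
Proof.
move=> i i' ii'.
pose u : 'rV[R]_2 := \row_j ((lift ord0 j == i)%:R - (lift ord0 j == i')%:R).
have : u *m (jac f)^T = 0.
  apply/rowP => k; rewrite !mxE.
  under eq_bigr do rewrite !mxE.
  pose F (l : 'I_3) := ((l == i)%:R - (l == i')%:R) *
    (pos (tri f l) k ord0 - pos (tri f ord0) k ord0).
  transitivity (\sum_l F l).
    rewrite [RHS]big_ord_recl.
    have -> : F ord0 = 0 by rewrite /F subrr mulr0.
    by rewrite add0r; apply: eq_bigr => j _; rewrite /F ?mxE.
  rewrite /F; under eq_bigr do rewrite mulrBl.
  rewrite sumrB (bigD1 i)//= eqxx mul1r big1 => [|l /negPf ->];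
    last by rewrite mul0r.
  rewrite (bigD1 i')//= eqxx mul1r big1 => [|l /negPf ->];
    last by rewrite mul0r.
  by rewrite ii' subrr.
move/jacT_inj => u0.
have U (j : 'I_2) : (lift ord0 j == i) = (lift ord0 j == i').
  have := congr1 (fun x : 'rV[R]_2 => x 0 j) u0; rewrite !mxE.
  by do 2 case: eqP => //; rewrite ?subr0 ?sub0r => _ _ /eqP;
    rewrite ?oppr_eq0 oner_eq0.
case: (unliftP ord0 i) => [j ij|i0].
  by have := U j; rewrite ij eqxx => /esym/eqP.
case: (unliftP ord0 i') => [j ij|->//].
by have := U j; rewrite ij eqxx => /eqP.
Qed.

Lemma tri_in_verts f i : tri f i \in verts f.
Proof. by apply/imsetP; exists i. Qed.

Lemma in_star f v : (f \in star v) = (v \in verts f).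
Proof. by rewrite inE. Qed.

Lemma varea_gt0 v : 0 < varea v.
Proof.
rewrite /varea mulr_gt0 ?invr_gt0//.
have [f vf] : exists f, v \in verts f by case: hM.
rewrite (bigD1 f) ?in_star//= ltr_wpDr ?farea_gt0//.
by apply: sumr_ge0 => g _; rewrite ltW ?farea_gt0.
Qed.

(** The last factor of [gradh]. *)
Let hat_diff : 'M[R]_(2, 3) := \matrix_(i < 2, j < 3)
  nth 0 (nth [::] [:: [:: -1; 1; 0]; [:: -1; 0; 1]] i) j.

Let hat_diffE (u : 'cV[R]_3) (i : 'I_2) :
  (hat_diff *m u) i 0 = u (lift ord0 i) 0 - u 0 0.
Proof.
rewrite !mxE !big_ord_recl big_ord0 !mxE.
case: i => [[|[|//]] hi] /=;
  rewrite !(mulN1r, mul0r, mul1r, addr0, add0r) addrC;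
  by congr (u _ _ - u _ _); apply/val_inj.
Qed.

Lemma gradh_const f a : \sum_i gradh f a i = 0.
Proof.
have : gradh f *m const_mx 1 = 0 :> 'cV_3.
  rewrite /gradh -/hat_diff -mulmxA.
  suff -> : hat_diff *m const_mx 1 = 0 :> 'cV_2 by rewrite mulmx0.
  by apply/colP => i; rewrite hat_diffE !mxE subrr.
move/matrixP/(_ a 0); rewrite !mxE => h; rewrite -[RHS]h.
by apply: eq_bigr => i _; rewrite [const_mx _ _ _]mxE mulr1.
Qed.

(** Multiplying the gradient by the transpose of the Jacobian leaves the
    differences u_1 - u_0 and u_2 - u_0. *)
Lemma gradh_inj f (u : 'I_3 -> R) :
  (forall a, \sum_i u i * gradh f a i = 0) -> forall i, u i = u ord0.
Proof.
move=> hu; pose U : 'cV[R]_3 := \col_i u i.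
have gU : gradh f *m U = 0.
  apply/colP => a; rewrite mxE [RHS]mxE -[RHS](hu a).
  by apply: eq_bigr => i _; rewrite [U _ _]mxE mulrC.
have dU : hat_diff *m U = 0.
  have := congr1 (mulmx (jac f)^T) gU; rewrite mulmx0 /gradh -/hat_diff.
  by rewrite -!mulmxA mulmxA mulmxA mulmxV ?gram_unit// mul1mx.
move=> i; case: (unliftP ord0 i) => [j ->|->//].
have := congr1 (fun x : 'cV[R]_2 => x j 0) dU; rewrite hat_diffE !mxE => /eqP.
by rewrite subr_eq0 => /eqP.
Qed.


Lemma hull_compact (S : {set 'I_(nV M)}) : compact (hull S).
Proof.
pose E : topologicalType := {ptws 'I_(nV M) -> R}.
pose comb (a : E) : 'cV[R]_3 := \sum_(v in S) a v *: pos v.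
pose B : set E := [set a | forall v, 0 <= a v <= 1].
pose tot (a : E) : R := \sum_(v in S) a v.
have c1 v : continuous (fun a : E => a v).
  exact: (@proj_continuous _ (fun=> R) v).
have ctot : continuous tot.
  by apply: continuous_big => [z|v _]; [exact: add_continuous|exact: c1].
have ccomb : continuous comb.
  apply: continuous_big => [z|v _]; first exact: add_continuous.
  by move=> a; exact: (@cvgZr_tmp R _ E (nbhs a) _ (fun a : E =>
    a v) (a v) (pos v) (c1 v a)).
have -> : hull S = comb @` (B `&` tot @^-1` [set x | x = 1]).
  apply/seteqP; split => x; last first.
    move=> [a [aB a1] <-]; exists a; split => //.
    by move=> v; have /andP[] := aB v.
  (* Outside S the coefficients are arbitrary; 0 puts them in the box. *)
  move=> [a [a0 a1 ->]]; exists (fun v => if v \in S then a v else 0).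
    split; last by rewrite /= /tot -[RHS]a1; apply: eq_bigr => v ->.
    move=> v /=; case: ifPn => vS; rewrite ?lexx ?ler01// a0/= -a1.
    by rewrite (bigD1 v)//= lerDl sumr_ge0.
  by rewrite /comb; apply: eq_bigr => v ->.
apply: continuous_compact; first exact: continuous_subspaceT.
apply: compact_closedI; first exact: box_compact.
by apply: closed_comp => //; exact: closed_eq.
Qed.

Lemma triangle_closed f : closed (triangle f).
Proof. by apply: compact_closed;
  [exact: norm_hausdorff|exact: hull_compact]. Qed.

Lemma pos_in_hull (S : {set 'I_(nV M)}) v : v \in S -> hull S (pos v).
Proof.
move=> vS; exists (fun u => (u == v)%:R); split.
- by move=> u; rewrite ler0n.
- rewrite (bigD1 v)//= eqxx big1 ?addr0// => u /andP[_ /negPf ->//].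
- rewrite (bigD1 v)//= eqxx scale1r big1 ?addr0// => u /andP[_ /negPf ->].
  by rewrite scale0r.
Qed.

(** The triangles on which u takes the value u v and those on which it does not
    have disjoint unions, because two triangles that meet share a vertex. Both
    unions are closed, so that one of them is the whole connected mesh. *)
Lemma constant_on_mesh (T : Type) (u : 'I_(nV M) -> T) :
  (forall f i j, u (tri f i) = u (tri f j)) -> forall v v', u v = u v'.
Proof.
move=> hu v v'.
have hu' f x y : x \in verts f -> y \in verts f -> u x = u y.
  by move=> /imsetP[i _ ->] /imsetP[j _ ->].
pose P f := u (tri f ord0) = u v.
pose C1 := \bigcup_(f in P) triangle f.
pose C2 := \bigcup_(f in ~` P) triangle f.
have cl (D : set 'I_(nT M)) : closed (\bigcup_(f in D) triangle f).
  by apply: closed_bigcup => [|f _];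
    [exact: finite_finset|exact: triangle_closed].
have dis : C1 `&` C2 = set0.
  rewrite -subset0 => x [[f Pf fx] [g Pg gx]] /=.
  have fg : f != g by apply/eqP => fg; apply: Pg; rewrite -fg.
  have no w : w \in verts f :&: verts g -> False.
    rewrite inE => /andP[wf wg]; apply: Pg.
    rewrite /P -(hu' g w) ?tri_in_verts// (hu' f w (tri f ord0))//.
    exact: tri_in_verts.
  case: hM => _ _ /(_ f g fg) meet _ _; case: meet.
  - by move=> e; have : (triangle f `&` triangle g) x by []; rewrite e.
  - by move=> [w /no].
  - by move=> [w [w' [_ /no]]].
have all : (\bigcup_f @triangle R M f) = C1 `|` C2.
  apply/seteqP; split => x.
    by move=> [f _ fx]; have [Pf|nPf] := pselect (P f); [left|right]; exists f.
  by move=> [|] [f _ fx]; exists f.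
have star_ex (x : 'I_(nV M)) : exists2 f, x \in verts f & True.
  by case: hM => _ _ _ /(_ x)[f xf] _; exists f.
have C1E : C1 = \bigcup_f @triangle R M f.
  case: hM => _ _ _ _; apply.
  - have [f vf _] := star_ex v; exists (pos v); exists f;
    last exact: pos_in_hull.
    by apply: (hu' f) => //; exact: tri_in_verts.
  - exists (~` C2); first by rewrite openC; exact: cl.
    rewrite all; apply/seteqP; split => x.
      move=> x1; split; first by left.
      by move=> x2; have : (C1 `&` C2) x by []; rewrite dis.
    by move=> [[//|]].
  - exists C1; first exact: cl.
    by rewrite all; apply/seteqP; split => x; [split => //; left|case].
have [f vf _] := star_ex v'.
have [Pf|nPf] := pselect (P f).
  by rewrite -Pf; apply: (hu' f) => //; exact: tri_in_verts.
have x2 : C2 (pos v') by exists f => //; exact: pos_in_hull.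
have : (C1 `&` C2) (pos v') by split => //; rewrite C1E all; right.
by rewrite dis.
Qed.

End MeshGeometry.

(** * Euclidean adjoints and second-order cones *)

Section Adjoints.
Variables (R : realType) (I J : finType).

Definition linear_map (L : vec R I -> vec R J) :=
  forall j, linear_form (fun x => L x j).

Lemma dotp_unitv (i : I) (y : vec R I) : dotp (unitv R i) y = y i.
Proof.
rewrite /dotp (bigD1 i)//= ffunE eqxx mul1r big1 ?addr0// => j /negPf ij.
by rewrite ffunE ij mul0r.
Qed.

Lemma dotp_eq (y y' : vec R I) : (forall x, dotp x y = dotp x y') -> y = y'.
Proof. by move=> h; apply/ffunP => i; rewrite -!dotp_unitv h. Qed.

Lemma dotpDr (x y y' : vec R I) : dotp x (y + y') = dotp x y + dotp x y'.
Proof. by rewrite -big_split; apply: eq_bigr => i _; rewrite ffunE mulrDr. Qed.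

Lemma dotpDl (x x' y : vec R I) : dotp (x + x') y = dotp x y + dotp x' y.
Proof. by rewrite -big_split; apply: eq_bigr => i _; rewrite ffunE mulrDl. Qed.

Lemma dotpNl (x y : vec R I) : dotp (- x) y = - dotp x y.
Proof. by rewrite -sumrN; apply: eq_bigr => i _; rewrite ffunE mulNr. Qed.

Lemma linear_form_dotp (y : vec R I) : linear_form (fun x => dotp x y).
Proof.
by apply: linear_form_sum => i x d t; rewrite ffunE; ring.
Qed.

Lemma adjE (L : vec R I -> vec R J) x y : linear_map L ->
  dotp x (adj L y) = dotp (L x) y.
Proof.
move=> hL; transitivity (\sum_i \sum_j x i * (L (unitv R i) j * y j)).
  by apply: eq_bigr => i _; rewrite ffunE mulr_sumr.
rewrite exchange_big; apply: eq_bigr => j _ /=.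
by rewrite (linear_formE x (hL j)) mulr_suml; apply: eq_bigr => i _;
    rewrite mulrA.
Qed.

Lemma stackK (x : vec R (I + J)%type) : stack (topv x) (botv x) = x.
Proof. by apply/ffunP => -[i|j]; rewrite !ffunE. Qed.

Lemma topv_stack (x : vec R I) (y : vec R J) : topv (stack x y) = x.
Proof. by apply/ffunP => i; rewrite !ffunE. Qed.

Lemma botv_stack (x : vec R I) (y : vec R J) : botv (stack x y) = y.
Proof. by apply/ffunP => i; rewrite !ffunE. Qed.

Lemma dotp_stack (x x' : vec R I) (y y' : vec R J) :
  dotp (stack x y) (stack x' y') = dotp x x' + dotp y y'.
Proof.
by rewrite /dotp big_sumType/=; congr (_ + _); apply: eq_bigr => i _;
    rewrite !ffunE.
Qed.

End Adjoints.

Lemma sum_unit (R : realType) (F : unit -> R) : \sum_s F s = F tt.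
Proof. by rewrite (bigD1 tt)//= big1 ?addr0//; case. Qed.

Section SecondOrderCone.
Variables (R : realType) (J : finType).
Implicit Types y z : vec R (unit + J)%type.

Definition in_soc y := Num.sqrt (\sum_j y (inr j) ^+ 2) <= y (inl tt).

Definition lorentz y z :=
  y (inl tt) * z (inl tt) - \sum_j y (inr j) * z (inr j).

Definition reflect_soc z : vec R (unit + J)%type :=
  [ffun s => match s with inl _ => z s | inr _ => - z s end].

Lemma in_socP y : in_soc y <-> 0 <= y (inl tt) /\ 0 <= lorentz y y.
Proof.
have s0 : 0 <= \sum_j y (inr j) ^+ 2 by apply: sumr_ge0 => *; exact: sqr_ge0.
have -> : lorentz y y = y (inl tt) ^+ 2 - \sum_j y (inr j) ^+ 2.
  by rewrite /lorentz; congr (_ - _).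
rewrite /in_soc subr_ge0; split => [h|[y0 h]].
  have y0 := le_trans (sqrtr_ge0 _) h; split => //.
  by rewrite -(sqr_sqrtr s0) ler_sqr ?nnegrE ?sqrtr_ge0.
by rewrite -(ler_pXn2r (n := 2)) ?nnegrE ?sqrtr_ge0// sqr_sqrtr.
Qed.

Lemma dotp_reflect z y : dotp z (reflect_soc y) = lorentz z y.
Proof.
rewrite /dotp /lorentz big_sumType/=; congr (_ + _).
  by rewrite sum_unit ffunE.
by rewrite -sumrN; apply: eq_bigr => j _; rewrite ffunE mulrN.
Qed.

(** When z_0 is nonzero, the sum of squares vanishes iff y is a multiple of the
    reflection of z; on the cone, the right-hand side is at most 2 z_0 y_0 <z,
    y>. *)
Lemma soc_cross z y :
  \sum_j (y (inr j) * z (inl tt) + y (inl tt) * z (inr j)) ^+ 2 =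
  2 * z (inl tt) * y (inl tt) * dotp z y
  - z (inl tt) ^+ 2 * lorentz y y - y (inl tt) ^+ 2 * lorentz z z.
Proof.
rewrite /dotp /lorentz big_sumType/= sum_unit.
have -> : \sum_j (y (inr j) * z (inl tt) + y (inl tt) * z (inr j)) ^+ 2 =
   z (inl tt) ^+ 2 * (\sum_j y (inr j) * y (inr j))
   + 2 * z (inl tt) * y (inl tt) * (\sum_j z (inr j) * y (inr j))
   + y (inl tt) ^+ 2 * (\sum_j z (inr j) * z (inr j)).
  by rewrite !mulr_sumr -!big_split/=; apply: eq_bigr => j _; ring.
by ring.
Qed.

(** Self-duality of the cone, and complementarity at a point z with positive
    head: an orthogonal y in the cone lies on the ray through the reflection of
    z. *)
Lemma soc_pair z y : in_soc z -> in_soc y -> 0 < z (inl tt) ->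
  0 <= dotp z y /\
  (dotp z y = 0 -> exists m, [/\ 0 <= m, m * lorentz z z = 0 &
     forall s, y s = m * reflect_soc z s]).
Proof.
move=> /in_socP[z0 zz] /in_socP[y0 yy] zp.
have := soc_cross z y.
have s0 : 0 <= \sum_j (y (inr j) * z (inl tt) + y (inl tt) * z (inr j)) ^+ 2.
  by apply: sumr_ge0 => *; exact: sqr_ge0.
have t1 : 0 <= z (inl tt) ^+ 2 * lorentz y y by rewrite mulr_ge0 ?sqr_ge0.
have t2 : 0 <= y (inl tt) ^+ 2 * lorentz z z by rewrite mulr_ge0 ?sqr_ge0.
move=> E; split.
  have [yp|yn|y00] := ltrgtP 0 (y (inl tt)); last first.
  - suff yj j : y (inr j) = 0.
      rewrite /dotp big1 // => -[[]|j] _; last by rewrite yj mulr0.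
      by rewrite -y00 mulr0.
    move: yy; rewrite /lorentz -y00 mulr0 sub0r oppr_ge0 => h.
    have h0 : \sum_j y (inr j) * y (inr j) = 0.
      by apply/eqP; rewrite eq_le h sumr_ge0// => i _; rewrite -expr2 sqr_ge0.
    have := psumr_eq0P _ h0; move/(_ _)/(_ j isT)/eqP;
      rewrite mulf_eq0 orbb => h1.
    by apply/eqP/h1 => i _; rewrite -expr2 sqr_ge0.
  - by lra.
  have h : 0 <= (2 * z (inl tt) * y (inl tt)) * dotp z y by lra.
  by move: h; rewrite pmulr_rge0// mulr_gt0// mulr_gt0.
move=> d0; rewrite d0 mulr0 in E.
have S0 : \sum_j (y (inr j) * z (inl tt) + y (inl tt) * z (inr j)) ^+ 2 =
    0 by lra.
exists (y (inl tt) / z (inl tt)).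
have ys s : y s = y (inl tt) / z (inl tt) * reflect_soc z s.
  case: s => [[]|j]; first by rewrite ffunE divfK// gt_eqF.
  have := psumr_eq0P _ S0; move/(_ _)/(_ j isT)/eqP; rewrite sqrf_eq0 => h.
  have {}h : y (inr j) * z (inl tt) + y (inl tt) * z (inr j) = 0.
    by apply/eqP/h => i _; exact: sqr_ge0.
  apply: (mulIf (x := z (inl tt))); first by rewrite gt_eqF.
  rewrite ffunE mulrAC divfK ?gt_eqF//; lra.
split => //; first by rewrite divr_ge0.
rewrite -dotp_reflect -d0 /dotp mulr_sumr; apply: eq_bigr => s _.
by rewrite (ys s); ring.
Qed.

End SecondOrderCone.

(** * Space-time operators and stationarity *)

Section SpaceTime.
Variables (R : realType) (M : mesh_data R) (N : nat).
Local Notation Vc := (Vc M N).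
Local Notation Vst := (Vst M N).
Local Notation Tc := (Tc M N).
Local Notation Tc3 := (Tc3 M N).
Local Notation Qi := (Qi M N).
Local Notation Zi := (Zi M N).
Local Notation Yi := (Yi M N).

Definition face_dot (B B' : vec R Tc3) : vec R Tc :=
  [ffun t => \sum_(a < 3) B (t, a) * B' (t, a)].

(** The derivative of [dot_g] at q in the direction q'; see [dot_g_line]. *)
Definition dot_dg (q q' : vec R Qi) : vec R Vst :=
  [ffun p => topv q' p + Lt (Ls_adj (face_dot (botv q) (botv q'))) p].

(** The gradient in q of the weighted pairing of [dot_g] with mu; see
    [dotp_Wq_momentum]. *)
Definition momentum (q : vec R Qi) (mu : vec R Vst) : vec R Qi :=
  stack mu [ffun p => Ls (Lt_adj mu) p.1 * botv q p].

Lemma linear_map_At : linear_map (@At R M N).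
Proof. by move=> p x d t; rewrite !ffunE; ring. Qed.

Lemma linear_map_As : linear_map (@As R M N).
Proof.
move=> p x d t; rewrite !ffunE mulr_sumr -big_split/=.
by apply: eq_bigr => i _; rewrite !ffunE; ring.
Qed.

Lemma stack_inl (I J : finType) (x : vec R I) (y : vec R J) i :
  stack x y (inl i) = x i.
Proof. by rewrite ffunE. Qed.

Lemma stack_inr (I J : finType) (x : vec R I) (y : vec R J) j :
  stack x y (inr j) = y j.
Proof. by rewrite ffunE. Qed.

Lemma linear_map_opA : linear_map (@opA R M N).
Proof.
move=> [p|p] x d t; rewrite /opA ?stack_inl ?stack_inr.
  exact: linear_map_At.
exact: linear_map_As.
Qed.

Lemma linear_map_opF : linear_map (@opF R M N).
Proof.
move=> [p|[[s i] [[k f] a]]] x d t; rewrite /opF ?stack_inl ?stack_inr.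
  by rewrite !ffunE.
by rewrite !ffunE.
Qed.

Lemma linear_map_opB : linear_map (@opB R M N).
Proof.
move=> [p|[m|p]] x d t; rewrite /opB !ffunE //; ring.
Qed.

Lemma linear_map_opT : linear_map (@opT R M N).
Proof.
move=> [p [u|[[[s [[i f] h]] a]|u]]] x d t; rewrite !ffunE //=.
by rewrite !ffunE; ring.
Qed.

Lemma linear_map_Lt_Ls_adj : linear_map (fun y : vec R Tc => Lt (Ls_adj y)).
Proof.
move=> p x d t; rewrite /Lt /Ls_adj !ffunE /=.
have H k : \sum_(f in star p.2) farea f * line x d t (k, f) =
   \sum_(f in star p.2) farea f * x (k,
     f) + t * \sum_(f in star p.2) farea f * d (k, f).
  by rewrite mulr_sumr -big_split/=; apply: eq_bigr => f _; rewrite ffunE; ring.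
by rewrite !H; ring.
Qed.

Lemma sqnormsE B : sqnorms B = face_dot B B :> vec R Tc.
Proof. by apply/ffunP => t; rewrite !ffunE; apply: eq_bigr => a _. Qed.

Lemma face_dot_ge0 B t : 0 <= face_dot B B t.
Proof. by rewrite ffunE; apply: sumr_ge0 => a _; rewrite -expr2 sqr_ge0. Qed.

Lemma dot_gE q p : dot_g q p =
  topv q p + 2^-1 * Lt (Ls_adj (face_dot (botv q) (botv q))) p :> R.
Proof. by rewrite /dot_g ffunE sqnormsE. Qed.

Lemma dot_g_line (q d : vec R Qi) t p : dot_g (line q d t) p =
  dot_g q p + t * dot_dg q d p
  + t ^+ 2 * (2^-1 * Lt (Ls_adj (face_dot (botv d) (botv d))) p).
Proof.
rewrite !dot_gE [dot_dg q d p]ffunE.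
have -> : face_dot (botv (line q d t)) (botv (line q d t)) =
  line (line (face_dot (botv q) (botv q)) (face_dot (botv q) (botv d)) (2 * t))
    (face_dot (botv d) (botv d)) (t ^+ 2).
  apply/ffunP => s; rewrite !ffunE !mulr_sumr -!big_split/=.
  by apply: eq_bigr => a _; rewrite !ffunE; ring.
have -> : topv (line q d t) p = topv q p + t * topv d p by rewrite !ffunE.
by rewrite !(linear_map_Lt_Ls_adj p); field.
Qed.

Hypothesis hM : is_mesh M.
Hypothesis hN : (0 < N)%N.

Let N0 : (0 : R) < N%:R. Proof. by rewrite ltr0n. Qed.

Let va0 (v : 'I_(nV M)) : varea v != 0 :> R.
Proof. by rewrite gt_eqF// varea_gt0. Qed.
Lemma Ls_adj_ge0 (y : vec R Tc) : (forall t, 0 <= y t) ->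
  forall p, 0 <= Ls_adj y p.
Proof.
move=> y0 [k v]; rewrite ffunE /=; apply: mulr_ge0.
  by rewrite invr_ge0 mulr_ge0// ltW// varea_gt0.
by apply: sumr_ge0 => f _; rewrite mulr_ge0// ltW// farea_gt0.
Qed.

Lemma Lt_Ls_adj_ge0 (y : vec R Tc) : (forall t, 0 <= y t) ->
  forall p, 0 <= Lt (Ls_adj y) p.
Proof.
move=> y0 p; have L0 := Ls_adj_ge0 y0.
by rewrite /Lt ffunE mulr_ge0 ?invr_ge0// addr_ge0.
Qed.

Let sum_fiber (h : 'I_N -> 'I_N.+1) (F : 'I_N -> R) (G : 'I_N.+1 -> R) :
  \sum_k (\sum_(l < N | h l == k) F l) * G k = \sum_l F l * G (h l).
Proof.
rewrite [RHS](partition_big h xpredT)//=; apply: eq_bigr => k _.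
by rewrite mulr_suml; apply: eq_bigr => l /eqP ->.
Qed.

Lemma Lt_adjoint (mu : vec R Vst) (phi : vec R Vc) :
  dotp (Lt phi) (WstV mu) = dotp phi (WcV (Lt_adj mu)).
Proof.
rewrite /dotp.
transitivity (\sum_(l < N) \sum_v Lt phi (l, v) * WstV mu (l, v)).
  by rewrite pair_big/=; apply: eq_bigr => -[].
transitivity (\sum_(k < N.+1) \sum_v phi (k, v) * WcV (Lt_adj mu) (k, v));
  last first.
  by rewrite pair_big/=; apply: eq_bigr => -[].
rewrite exchange_big [RHS]exchange_big/=; apply: eq_bigr => v _.
transitivity (varea v / N%:R / 2 * (\sum_l mu (l, v) * phi (tnext l, v)
  + \sum_l mu (l, v) * phi (tprev l, v))).
  by rewrite -big_split mulr_sumr; apply: eq_bigr => l _;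
    rewrite !ffunE/=; ring.
rewrite -(sum_fiber (@tnext N) (fun l => mu (l, v)) (fun k => phi (k, v))).
rewrite -(sum_fiber (@tprev N) (fun l => mu (l, v)) (fun k => phi (k, v))).
rewrite -big_split mulr_sumr; apply: eq_bigr => k _; rewrite !ffunE/=; ring.
Qed.

Lemma Ls_adjoint (y : vec R Tc) (phi : vec R Vc) :
  dotp (Ls_adj y) (WcV phi) = \sum_t farea t.2 / N%:R * Ls phi t * y t.
Proof.
rewrite /dotp.
transitivity (\sum_(k < N.+1) \sum_v Ls_adj y (k, v) * WcV phi (k, v)).
  by rewrite pair_big/=; apply: eq_bigr => -[].
transitivity (\sum_(k < N.+1) \sum_(f : 'I_(nT M))
    farea f / N%:R * Ls phi (k, f) * y (k, f)); last first.
  by rewrite pair_big/=; apply: eq_bigr => -[].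
apply: eq_bigr => k _.
transitivity (\sum_v \sum_(f in star v)
    (3 * N%:R)^-1 * farea f * y (k, f) * phi (k, v)).
  apply: eq_bigr => v _; rewrite !ffunE/= mulr_sumr mulr_suml.
  by apply: eq_bigr => f _; field; rewrite va0 gt_eqF.
rewrite (exchange_big_dep xpredT)//=; apply: eq_bigr => f _.
rewrite ffunE/= !(mulr_sumr, mulr_suml).
apply: eq_big => [v|v _]; first by rewrite in_star.
by field; rewrite gt_eqF.
Qed.

Lemma dotp_Wq_momentum (q q' : vec R Qi) (mu : vec R Vst) :
  dotp q' (Wq (momentum q mu)) = \sum_p dot_dg q q' p * WstV mu p.
Proof.
transitivity (dotp (topv q') (WstV mu)
  + dotp (Lt (Ls_adj (face_dot (botv q) (botv q')))) (WstV mu)); last first.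
  by rewrite -big_split/=; apply: eq_bigr => p _; rewrite [in RHS]ffunE mulrDl.
rewrite Lt_adjoint Ls_adjoint -{1}[q']stackK /Wq dotp_stack topv_stack.
congr (_ + _); rewrite botv_stack /dotp.
transitivity (\sum_(t : Tc) \sum_(a < 3) botv q' (t, a) *
   WcT [ffun p => Ls (Lt_adj mu) p.1 * botv q p] (t, a)).
  by rewrite pair_big/=; apply: eq_bigr => -[].
apply: eq_bigr => t _; rewrite [face_dot _ _ _]ffunE mulr_sumr.
by apply: eq_bigr => a _;
    rewrite [WcT _ _]ffunE [X in _ * (_ * X)]ffunE/=; ring.
Qed.

Lemma Wq_inj : injective (@Wq R M N).
Proof.
move=> x y xy; rewrite -[x]stackK -[y]stackK.
have H p := congr1 (fun z : vec R Qi => z p) xy.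
congr stack; apply/ffunP => p.
  have := H (inl p); rewrite /= /Wq !stack_inl [WstV _ _]ffunE [in RHS]ffunE.
  by apply: mulfI; rewrite mulf_neq0// ?invr_eq0 gt_eqF ?varea_gt0.
have := H (inr p); rewrite /= /Wq !stack_inr [WcT _ _]ffunE [in RHS]ffunE.
by apply: mulfI; rewrite mulf_neq0// ?invr_eq0 gt_eqF ?farea_gt0.
Qed.

(** Both KKT systems contain the left-hand side as their stationarity in q,
    whereas the right-hand side gives both lambda_0 = mu and the formula for
    the momentum. *)
Lemma stationary_q (q lam : vec R Qi) (mu : vec R Vst) :
  (forall q', dotp q' (Wq lam) = \sum_p dot_dg q q' p * WstV mu p) <->
  lam = momentum q mu.
Proof.
split => [h|-> q']; last exact: dotp_Wq_momentum.
by apply: Wq_inj; apply: dotp_eq => q'; rewrite h dotp_Wq_momentum.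
Qed.

Lemma stationary_phi (c : vec R Vc) (y : vec R Qi) :
  (forall phi, dot_cV phi c + dotp (opA phi) y = 0) <->
  WcV c + adj (@opA R M N) y = 0.
Proof.
have E phi : dotp phi (WcV c + adj (@opA R M N) y) =
    dot_cV phi c + dotp (opA phi) y.
  by rewrite dotpDr adjE//; exact: linear_map_opA.
split => [h|h phi].
  apply: dotp_eq => phi; rewrite E h.
  by apply/esym/big1 => i _; rewrite ffunE mulr0.
by rewrite -E h; apply: big1 => i _; rewrite ffunE mulr0.
Qed.

End SpaceTime.

(** * The blocks of the cone program *)

Section BlockCones.
Variables (R : realType) (M : mesh_data R) (N : nat).
Hypothesis hM : is_mesh M.

Local Notation Vst := (Vst M N).
Local Notation Qi := (Qi M N).
Local Notation Zi := (Zi M N).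
Local Notation Yi := (Yi M N).

(** The vertices of a triangle are distinct, so that the sets T_(v,1), T_(v,2),
    T_(v,3) partition T_v. *)
Lemma sum_starn (v : 'I_(nV M)) (F : 'I_(nT M) -> R) :
  \sum_i \sum_(f in starn v i) F f = \sum_(f in star v) F f.
Proof.
rewrite (exchange_big_dep (fun f => f \in star v))/=; last first.
  by move=> i f _; rewrite inE => /andP[].
apply: eq_bigr => f fv.
have /imsetP[i _ vi] : v \in verts f by rewrite -in_star.
rewrite (big_pred1 i)// => j; rewrite inE fv vi /=.
by rewrite (inj_eq (tri_inj hM (f := f))).
Qed.

Lemma sum_blk_tail (v : 'I_(nV M)) (G : bool -> 'I_(nT M) -> 'I_3 ->
  R) (H : blk_tail v -> R) :
  (forall s x a, H (inl ((s, x), a)) = G s (val x).2 a) ->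
  \sum_j H j = \sum_(f in star v) \sum_a (G false f a + G true f a) +
      H (inr tt).
Proof.
move=> hH; rewrite big_sumType/= sum_unit; congr (_ + _).
transitivity (\sum_(sx : bool * {x : 'I_3 * 'I_(nT M) | x.2 \in starn v x.1})
    \sum_a H (inl (sx, a))).
  by rewrite pair_big/=; apply: eq_bigr => -[].
transitivity (\sum_s \sum_(x : {x : 'I_3 * 'I_(nT M) | x.2 \in starn v x.1})
    \sum_a H (inl ((s, x), a))).
  by rewrite [RHS]pair_big/=; apply: eq_bigr => -[].
have S s : \sum_(x : {x : 'I_3 * 'I_(nT M) | x.2 \in starn v x.1})
    \sum_a H (inl ((s, x), a)) = \sum_(f in star v) \sum_a G s f a.
  transitivity (\sum_(x : {x : 'I_3 * 'I_(nT M) | x.2 \in starn v x.1})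
     \sum_a G s (val x).2 a).
    by apply: eq_bigr => x _; apply: eq_bigr => a _; exact: hH.
  rewrite -(big_sub [pred x : 'I_3 * 'I_(nT M) | x.2 \in starn v x.1]
    (fun x => \sum_a G s x.2 a)).
  rewrite -sum_starn [RHS]pair_big_dep/=.
  by apply: eq_bigl => x; rewrite inE.
rewrite big_bool/= !S addrC -big_split/=; apply: eq_bigr => f _.
by rewrite -big_split.
Qed.

Definition cone_dblock (q : vec R Qi) (p : Vst) : vec R (blk p.2) :=
    opTkv p (opB (opF q)).
Definition cone_block (q : vec R Qi) (p : Vst) : vec R (blk p.2) :=
  opTkv p (opB (opF q) + @dvec R M N).

Let tail_dot (q q' : vec R Qi) (p : Vst) :
  \sum_(f in star p.2) \sum_a
     ((farea f / varea p.2) * 3^-1 * (botv q ((tprev p.1, f),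
       a) * botv q' ((tprev p.1, f), a))
     + (farea f / varea p.2) * 3^-1 * (botv q ((tnext p.1, f),
       a) * botv q' ((tnext p.1, f), a)))
  = 2 * Lt (Ls_adj (face_dot (botv q) (botv q'))) p.
Proof.
rewrite /Lt [in RHS]ffunE /Ls_adj ![in RHS]ffunE /= mulrA mulfV// mul1r.
rewrite -mulrDr -big_split/= mulr_sumr; apply: eq_bigr => f _.
rewrite !ffunE -mulrDr -big_split/= !mulr_sumr; apply: eq_bigr => a _.
by field; rewrite gt_eqF// varea_gt0.
Qed.

(** The factor sqrt 3 / 3 of B squares to the factor 1/3 of Ls^*. *)
Let sqrt_coef (f : 'I_(nT M)) (v : 'I_(nV M)) (x y : R) :
  Num.sqrt (farea f / varea v) * (Num.sqrt 3 / 3 * x) *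
  (Num.sqrt (farea f / varea v) * (Num.sqrt 3 / 3 * y)) =
  (farea f / varea v) * 3^-1 * (x * y).
Proof.
have h1 : Num.sqrt (farea f / varea v) ^+ 2 = farea f / varea v.
  by rewrite sqr_sqrtr// divr_ge0// ltW ?farea_gt0 ?varea_gt0.
have h2 : Num.sqrt 3 ^+ 2 = 3 :> R by rewrite sqr_sqrtr.
transitivity (Num.sqrt (farea f / varea v) ^+ 2 * Num.sqrt 3 ^+ 2 / 9 *
    (x * y)).
  by field.
by rewrite h1 h2; field; rewrite gt_eqF// varea_gt0.
Qed.

Lemma cone_block_head (q : vec R Qi) p : cone_block q p (inl tt) = 1 - topv q p.
Proof. by rewrite !ffunE addrC. Qed.

Lemma cone_block_last (q : vec R Qi) p :
    cone_block q p (inr (inr tt)) = 1 + topv q p.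
Proof. by rewrite !ffunE addrC. Qed.

Lemma cone_block_mid (q : vec R Qi) p s x a :
    cone_block q p (inr (inl ((s, x), a))) =
  Num.sqrt (farea (val x).2 / varea p.2) * (Num.sqrt 3 / 3 *
    botv q ((if s then tnext p.1 else tprev p.1, (val x).2), a)).
Proof.
case: x => [[i f] h]; rewrite [LHS]ffunE /=; congr (_ * _).
by rewrite !ffunE addr0.
Qed.

Lemma cone_dblock_head (q : vec R Qi) p : cone_dblock q p (inl tt) = - topv q p.
Proof. by rewrite !ffunE. Qed.

Lemma cone_dblock_last (q : vec R Qi) p :
    cone_dblock q p (inr (inr tt)) = topv q p.
Proof. by rewrite !ffunE. Qed.

Lemma cone_dblock_mid (q : vec R Qi) p s x a :
    cone_dblock q p (inr (inl ((s, x), a))) =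
  Num.sqrt (farea (val x).2 / varea p.2) * (Num.sqrt 3 / 3 *
    botv q ((if s then tnext p.1 else tprev p.1, (val x).2), a)).
Proof.
case: x => [[i f] h]; rewrite [LHS]ffunE /=; congr (_ * _).
by rewrite !ffunE.
Qed.

(** The heads contribute - (1 - A) A', the last entries - (1 + A) A' and the
    vectors in between - 2 Lt Ls^*(B . B'). *)
Lemma lorentz_cone_dblock (q q' : vec R Qi) (p : Vst) :
  lorentz (cone_block q p) (cone_dblock q' p) = - 2 * dot_dg q q' p.
Proof.
rewrite /lorentz (sum_blk_tail
  (G := fun s f a => let k := if s then tnext p.1 else tprev p.1 in
     (farea f / varea p.2) * 3^-1 * (botv q ((k, f), a) * botv q' ((k, f),
       a)))); last first.
  by move=> s x a; rewrite cone_block_mid cone_dblock_mid sqrt_coef.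
rewrite tail_dot /dot_dg [in RHS]ffunE cone_block_head cone_dblock_head
  cone_block_last cone_dblock_last.
by ring.
Qed.

(** (1 - A)^2 - (1 + A)^2 = - 4 A. *)
Lemma lorentz_cone_block (q : vec R Qi) (p : Vst) :
  lorentz (cone_block q p) (cone_block q p) = - 4 * dot_g q p.
Proof.
rewrite /lorentz (sum_blk_tail
  (G := fun s f a => let k := if s then tnext p.1 else tprev p.1 in
     (farea f / varea p.2) * 3^-1 * (botv q ((k, f), a) * botv q ((k, f),
       a)))); last first.
  by move=> s x a; rewrite cone_block_mid sqrt_coef.
rewrite tail_dot dot_gE cone_block_head cone_block_last.
by field.
Qed.

Definition slice (y : vec R Yi) (p : Vst) : vec R (blk p.2) :=
  [ffun b => y (Tagged (fun p : Vst => blk p.2) b)].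

Lemma slice_opT (z : vec R Zi) p : slice (opT z) p = opTkv p z.
Proof. by apply/ffunP => b; rewrite [LHS]ffunE [LHS]ffunE. Qed.

Lemma coneQ_opT (z : vec R Zi) : coneQ (opT z) <-> forall p, in_soc (opTkv p z).
Proof. by split => h p; have := h p; rewrite /Ksoc /in_soc -slice_opT. Qed.

(** The form is nonnegative iff g <= 0; this also gives A <= 0, hence a
    positive head 1 - A. *)
Lemma in_soc_cone_block (q : vec R Qi) p :
    in_soc (cone_block q p) <-> dot_g q p <= 0.
Proof.
rewrite in_socP lorentz_cone_block cone_block_head; split => [[_ h]|h];
  first by lra.
split; last by lra.
have := h; rewrite dot_gE.
have := Lt_Ls_adj_ge0 hM (face_dot_ge0 (botv q)) p; lra.
Qed.

Lemma dotp_opT (z : vec R Zi) (y : vec R Yi) :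
  dotp (opT z) y = \sum_p dotp (opTkv p z) (slice y p).
Proof.
rewrite /dotp.
transitivity (\sum_p \sum_(b : blk p.2) opTkv p z b *
    y (Tagged (fun p : Vst => blk p.2) b)).
  rewrite (sig_big_dep xpredT (fun _ => xpredT) (fun p b =>
    opTkv p z b * y (Tagged (fun p : Vst => blk p.2) b))).
  by apply: eq_bigr => -[p b] _; rewrite ffunE.
by apply: eq_bigr => p _; apply: eq_bigr => b _; rewrite [slice _ _ _]ffunE.
Qed.
End BlockCones.

(** * The two KKT systems *)

Section KKTSystems.
Variables (R : realType) (M : mesh_data R) (N : nat).
Hypothesis hM : is_mesh M.
Hypothesis hN : (0 < N)%N.

Local Notation Vc := (Vc M N).
Local Notation Vst := (Vst M N).
Local Notation Tc := (Tc M N).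
Local Notation Tc3 := (Tc3 M N).
Local Notation Qi := (Qi M N).
Local Notation Zi := (Zi M N).
Local Notation Yi := (Yi M N).

Let N0 : (0 : R) < N%:R. Proof. by rewrite ltr0n. Qed.

Lemma weight_gt0 (v : 'I_(nV M)) : 0 < varea v / N%:R.
Proof. by rewrite divr_gt0// varea_gt0. Qed.

Lemma dotp_WzC (x z : vec R Zi) : dotp x (Wz z) = dotp z (Wz x).
Proof.
rewrite /dotp; apply: eq_bigr => -[p|[[m t]|p]] _; rewrite !ffunE /=; ring.
Qed.

Lemma Wz_surj (x : vec R Zi) : exists beta, Wz beta = x.
Proof.
exists [ffun s => match s with
   | inl p => x s / (varea p.2 / N%:R)
   | inr (inl m) => x s / (farea m.2.1.2 / N%:R)
   | inr (inr p) => x s / (varea p.2 / N%:R) end].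
apply/ffunP => -[p|[[si [[k f] a]]|p]]; rewrite !ffunE /=.
- by rewrite mulrC divfK// gt_eqF// weight_gt0.
- by rewrite mulrC divfK// gt_eqF// divr_gt0// farea_gt0.
- by rewrite mulrC divfK// gt_eqF// weight_gt0.
Qed.

(** Pairing with a reflection is the Lorentz product, which the blocks turn
    into the derivative of g. *)
Lemma dotp_adj_cone_dblock (q q' : vec R Qi) (y : vec R Yi) (m : vec R Vst) :
  (forall p s, slice y p s = m p * reflect_soc (cone_block q p) s) ->
  dotp q' (adj (@opF R M N) (adj (@opB R M N) (adj (@opT R M N) y))) =
  \sum_p m p * (- 2 * dot_dg q q' p).
Proof.
move=> hy; rewrite adjE; last exact: linear_map_opF.
rewrite adjE; last exact: linear_map_opB.
rewrite adjE; last exact: linear_map_opT.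
rewrite dotp_opT; apply: eq_bigr => p _; rewrite -(lorentz_cone_dblock hM).
have -> : slice y p = [ffun s => m p * reflect_soc (cone_block q p) s].
  by apply/ffunP => s; rewrite hy [RHS]ffunE.
rewrite [lorentz _ _](_ : _ = lorentz (cone_dblock q' p) (cone_block q p));
  last first.
  by rewrite /lorentz mulrC; congr (_ - _); apply: eq_bigr => j _;
    rewrite mulrC.
rewrite -dotp_reflect /dotp mulr_sumr; apply: eq_bigr => s _.
by rewrite [X in _ * X = _]ffunE mulrCA.
Qed.

(** The multiplier mu is 2 m divided by the weights, where m_p is the ratio of
    the block of y to the reflected block of z. *)
Lemma KKT_dot_of_soc c phi (q : vec R Qi) z alpha (beta : vec R Zi) :
  KKT_soc c phi q z alpha beta ->
  KKT_dot c phi q (topv alpha) (botv alpha) (- topv alpha).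
Proof.
move=> [[Aq <-] stphi stq [/coneQ_opT zQ [y yQ yb] compl]].
have g_le0 p : dot_g q p <= 0 by apply/(in_soc_cone_block hM)/zQ.
have z_gt0 p : 0 < cone_block q p (inl tt).
  rewrite cone_block_head; have := g_le0 p; rewrite dot_gE.
  have := Lt_Ls_adj_ge0 hM (face_dot_ge0 (botv q)) p; lra.
have pair p := soc_pair (zQ p) (yQ p) (z_gt0 p).
have sum0 : \sum_p dotp (cone_block q p) (slice y p) = 0.
  rewrite -dotp_opT -adjE; last exact: linear_map_opT.
  by rewrite -yb -dotp_WzC.
have each p : dotp (cone_block q p) (slice y p) = 0.
  by apply: (psumr_eq0P _ sum0) => // p' _; exact: (pair p').1.
have /choice[m hm] p : exists m : R, [/\ 0 <= m,
    m * lorentz (cone_block q p) (cone_block q p) = 0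
  & forall s, slice y p s = m * reflect_soc (cone_block q p) s].
  exact: (pair p).2 (each p).
pose mu : vec R Vst := [ffun p => 2 * m p / (varea p.2 / N%:R)].
have muE p : WstV mu p = 2 * m p.
  by rewrite !ffunE mulrC divfK// gt_eqF// weight_gt0.
have alphaE : alpha = momentum q mu.
  apply/(stationary_q hM hN) => q'.
  have := congr1 (dotp q') stq; rewrite dotpDr yb.
  rewrite (@dotp_adj_cone_dblock q q' y [ffun p => m p]); last first.
    by move=> p s; rewrite [X in X * _]ffunE; have [_ _] := hm p.
  have -> : dotp q' 0 = 0 by apply: big1 => i _; rewrite ffunE mulr0.
  move/eqP; rewrite addr_eq0 => /eqP ->; rewrite -sumrN.
  by apply: eq_bigr => p _; rewrite muE ffunE; ring.
have topE : topv alpha = mu by rewrite alphaE topv_stack.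
split => //.
- by rewrite stackK.
- by rewrite subrr.
- rewrite topE; split=> //.
    move=> p; rewrite ffunE divr_ge0 ?(ltW (weight_gt0 _))//.
    by rewrite mulr_ge0//; have [] := hm p.
  rewrite /dotp big1// => p _; rewrite [mu p]ffunE.
  have [_ h _] := hm p; rewrite (lorentz_cone_block hM) in h.
  have {}h : m p * dot_g q p = 0 by lra.
  transitivity (2 / (varea p.2 / N%:R) * (m p * dot_g q p)); first by ring.
  by rewrite h mulr0.
- by rewrite topE alphaE botv_stack.
Qed.

Lemma complementary_terms (q : vec R Qi) (lam : vec R Vst) :
  (forall p, 0 <= lam p) -> (forall p, dot_g q p <= 0) ->
  dotp lam (dot_g q) = 0 -> forall p, lam p * dot_g q p = 0.
Proof.
move=> l0 g0 h p; apply/eqP; rewrite -oppr_eq0; apply/eqP.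
apply: (psumr_eq0P (P := xpredT) (F := fun p => - (lam p * dot_g q p))) => //
  [p' _|].
  by rewrite -mulrN mulr_ge0// oppr_ge0.
by rewrite sumrN; apply/eqP; rewrite oppr_eq0; apply/eqP; exact: h.
Qed.

(** The block of y at p is the reflected block of z times half the weighted
    multiplier, which inverts the relation mu = 2 m / weight. *)
Lemma KKT_soc_of_dot c phi (q : vec R Qi) lam0 lamb lamq :
  KKT_dot c phi q lam0 lamb lamq ->
  exists z alpha beta, KKT_soc c phi q z alpha beta.
Proof.
move=> [Aq stphi _ [l0 lg g0] lambE].
pose m : vec R Vst := [ffun p => WstV lam0 p / 2].
have m0 p : 0 <= m p by rewrite !ffunE divr_ge0// mulr_ge0// ltW// weight_gt0.
pose y : vec R Yi := [ffun s =>
  m (tag s) * reflect_soc (cone_block q (tag s)) (tagged s)].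
have ys p s : slice y p s = m p * reflect_soc (cone_block q p) s.
  by rewrite [LHS]ffunE [LHS]ffunE.
have [beta bE] := Wz_surj (adj (@opT R M N) y).
exists (opB (opF q) + @dvec R M N), (stack lam0 lamb), beta.
have zQ p : in_soc (cone_block q p) by apply/(in_soc_cone_block hM).
split => //.
  have -> : stack lam0 lamb = momentum q lam0 by rewrite lambE.
  rewrite bE; apply: dotp_eq => q'.
  rewrite dotpDr (dotp_Wq_momentum hM hN)
      (dotp_adj_cone_dblock _ ys) -big_split/=.
  rewrite [RHS]big1 => [|i _]; last by rewrite ffunE mulr0.
  by apply: big1 => p _; rewrite [m p]ffunE; field.
split.
- exact/coneQ_opT.
- exists y => // p; rewrite -/(slice y p).
  have [z0 zz] := (in_socP _).1 (zQ p).
  apply/in_socP; split; first by rewrite ys [reflect_soc _ _]ffunE mulr_ge0.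
  have -> : lorentz (slice y p) (slice y p) =
      m p ^+ 2 * lorentz (cone_block q p) (cone_block q p).
    rewrite /lorentz !ys ![reflect_soc _ _]ffunE mulrBr mulr_sumr;
      congr (_ - _); first by ring.
    by apply: eq_bigr => j _; rewrite !ys ![reflect_soc _ _]ffunE; ring.
  by rewrite mulr_ge0// sqr_ge0.
- rewrite /dot_z dotp_WzC bE adjE; last exact: linear_map_opT.
  rewrite dotp_opT big1// => p _.
  have -> : dotp (opTkv p (opB (opF q) + @dvec R M N)) (slice y p) =
     m p * dotp (cone_block q p) (reflect_soc (cone_block q p)).
    by rewrite /dotp mulr_sumr; apply: eq_bigr => s _; rewrite ys mulrCA.
  rewrite dotp_reflect (lorentz_cone_block hM).
  rewrite [m p]ffunE [WstV _ _]ffunE.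
  transitivity (varea p.2 / N%:R / 2 * - 4 * (lam0 p * dot_g q p));
    first by ring.
  by rewrite (complementary_terms l0 g0 lg) mulr0.
Qed.

Lemma is_derive_quadratic (x y z : R) :
  is_derive (0 : R) (1 : R) (fun t : R => x + t * y + t ^+ 2 * z) y.
Proof.
have h1 : is_derive (0:R) (1:R) (fun t : R => t * y) y.
  have := @is_derive_id R R 0 1.
  have -> : (fun t : R => t * y) = y \*: id.
    by apply/funext => t; rewrite /= mulrC.
  move=> h; have := @is_deriveZ R R R id y 0 1 _ h.
  by rewrite /GRing.scale /= mulr1.
have h2 : is_derive (0:R) (1:R) (fun t : R => t * (t * z)) 0.
  have -> : (fun t : R => t * (t * z)) = (id : R -> R) * (z \*: (id : R -> R)).
    by apply/funext => t; rewrite [t * z]mulrC.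
  have h := @is_derive_id R R 0 1.
  have h' := @is_deriveZ R R R id z 0 1 _ h.
  have := @is_deriveM R R id (z \*: id) 0 1 _ _ h h'.
  by rewrite /= scale0r scaler0 scale0r addr0.
have h3 := @is_derive_cst R R R x 0 1.
have h4 := @is_deriveD R R R _ _ 0 1 _ _
    (@is_deriveD R R R _ _ 0 1 _ _ h3 h1) h2.
move: h4; rewrite add0r addr0.
by congr (is_derive _ _ _ _); apply/funext => t; rewrite expr2 -mulrA.
Qed.

Let dotp_WstV_line (q d : vec R Qi) (mu : vec R Vst) t :
  dotp (dot_g (line q d t)) (WstV mu) =
  dotp (dot_g q) (WstV mu) + t * (\sum_p dot_dg q d p * WstV mu p)
  + t ^+ 2 * \sum_p (2^-1 * Lt
      (Ls_adj (face_dot (botv d) (botv d))) p) * WstV mu p.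
Proof.
rewrite !mulr_sumr -!big_split/=; apply: eq_bigr => p _.
by rewrite dot_g_line; ring.
Qed.

Lemma dot_lagrangian_line (c phi dphi : vec R Vc) (q dq lam : vec R Qi)
    (mu : vec R Vst) : exists x z, forall t,
  dot_lagrangian c (line phi dphi t) (line q dq t) lam mu = x
  + t * (dot_cV dphi c + dotp (opA dphi) (Wq lam) - dotp dq (Wq lam)
         + \sum_p dot_dg q dq p * WstV mu p) + t ^+ 2 * z.
Proof.
exists (dot_lagrangian c phi q lam mu).
exists (\sum_p
    (2^-1 * Lt (Ls_adj (face_dot (botv dq) (botv dq))) p) * WstV mu p).
move=> t.
rewrite /dot_lagrangian dotp_WstV_line !dotpDl !dotpNl.
have -> : opA (line phi dphi t) = line (opA phi) (opA dphi) t.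
  by apply/ffunP => s; rewrite (linear_map_opA s) [RHS]ffunE.
rewrite /dot_cV !linear_form_dotp.
by ring.
Qed.

(** Directions with dq = 0 give the equation for phi, those with dphi = 0 give
    the equation for q, which [stationary_q] solves for lam. *)
Lemma KKT_dot_lagrangian (c phi : vec R Vc) (q : vec R Qi) lam0 lamb lamq :
  KKT_dot c phi q lam0 lamb lamq <->
  dot_KKT_point c phi q (stack lam0 lamb) (- lamq).
Proof.
split.
  move=> [Aq stphi lamE [l0 lg g0] lambE].
  have -> : - lamq = lam0 by apply/esym/eqP; rewrite -addr_eq0 lamE.
  split => // [p|dphi dq]; first exact: complementary_terms.
  have [x [z H]] := dot_lagrangian_line c phi dphi q dq (stack lam0 lamb) lam0.
  rewrite (funext H).
  have /stationary_phi -> := stphi.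
  have -> : stack lam0 lamb = momentum q lam0 by rewrite lambE.
  by rewrite (dotp_Wq_momentum hM hN) sub0r addNr; exact: is_derive_quadratic.
move=> [Aq g0 mu0 compl st].
have D dphi dq : dot_cV dphi c + dotp (opA dphi) (Wq (stack lam0 lamb))
   - dotp dq (Wq (stack lam0 lamb)) + \sum_p dot_dg q dq p * WstV (- lamq) p =
     0.
  have [x [z H]] :=
      dot_lagrangian_line c phi dphi q dq (stack lam0 lamb) (- lamq).
  have := st dphi dq; rewrite (funext H) => d1.
  have d2 := is_derive_quadratic x (dot_cV dphi c +
      dotp (opA dphi) (Wq (stack lam0 lamb))
   - dotp dq (Wq (stack lam0 lamb)) + \sum_p dot_dg q dq p * WstV (- lamq) p) z.
  by rewrite -(@derive_val _ _ _ _ _ _ _ d2) (@derive_val _ _ _ _ _ _ _ d1).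
have dot0 (I : finType) (y : vec R I) : dotp 0 y = 0.
  by apply: big1 => i _; rewrite ffunE mul0r.
have A0 : opA (0 : vec R Vc) = 0.
  by apply/ffunP => s; rewrite (linear_form0 (linear_map_opA s)) ffunE.
have lamE : stack lam0 lamb = momentum q (- lamq).
  apply/(stationary_q hM hN) => dq; have := D 0 dq.
  by rewrite A0 /dot_cV !dot0 add0r sub0r addrC => /eqP;
    rewrite subr_eq0 => /eqP.
have l0E : lam0 = - lamq.
  by have := congr1 (@topv _ _ _) lamE; rewrite !topv_stack.
split => //.
- apply/stationary_phi => dphi; have := D dphi 0;
  rewrite dot0 subr0 big1 ?addr0// => p _.
  rewrite (_ : dot_dg q 0 p = 0) ?mul0r//.
  have z0 : face_dot (botv q) (botv (0 : vec R Qi)) = 0.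
    by apply/ffunP => t; rewrite !ffunE big1// => a _; rewrite !ffunE mulr0.
  rewrite [LHS]ffunE z0 (linear_form0 (linear_map_Lt_Ls_adj p)) addr0.
  by rewrite !ffunE.
- by rewrite l0E addNr.
- split => //; first by rewrite l0E.
  by rewrite /dotp big1// => p _; rewrite l0E.
- by have := congr1 (@botv _ _ _) lamE; rewrite !botv_stack l0E.
Qed.

(** This writes the quadratic part of g as a combination of squares with
    nonnegative weights. *)
Lemma Lt_Ls_adj_face_dot (B B' : vec R Tc3) (p : Vst) :
  \sum_m Lt (Ls_adj (unitv R m.1)) p * (B m * B' m) =
      Lt (Ls_adj (face_dot B B')) p.
Proof.
rewrite (linear_formE _ (linear_map_Lt_Ls_adj p)).
transitivity (\sum_(t : Tc) \sum_(a < 3)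
   Lt (Ls_adj (unitv R t)) p * (B (t, a) * B' (t, a))).
  by rewrite pair_big/=; apply: eq_bigr => -[].
by apply: eq_bigr => t _; rewrite [face_dot _ _ _]ffunE mulrC mulr_sumr.
Qed.

Lemma integer_time_cases (k : 'I_N.+1) : exists l : 'I_N,
  k = tnext l \/ k = tprev l.
Proof.
case: (unliftP ord0 k) => [l ->|->]; first by exists l; left.
by exists (Ordinal hN); right; apply/val_inj.
Qed.

(** Every integer time is next to a staggered one, and every triangle has a
    vertex. *)
Lemma Lt_Ls_adj_eq0 (y : vec R Tc) : (forall t, 0 <= y t) ->
  (forall p, Lt (Ls_adj y) p = 0) -> forall t, y t = 0.
Proof.
move=> y0 h [k f].
have hk : Ls_adj y (k, tri f ord0) = 0.
  have [l kl] := integer_time_cases k.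
  have := h (l, tri f ord0); rewrite [LHS]ffunE /=.
  have := Ls_adj_ge0 hM y0 (tnext l, tri f ord0).
  have := Ls_adj_ge0 hM y0 (tprev l, tri f ord0).
  by case: kl => ->; lra.
move: hk; rewrite ffunE /= => /eqP;
  rewrite mulf_eq0 invr_eq0 mulf_eq0 pnatr_eq0/=.
rewrite gt_eqF ?varea_gt0//= => /eqP hk.
have := psumr_eq0P _ hk; move/(_ _)/(_ f); rewrite in_star tri_in_verts => h'.
have /eqP : farea f * y (k, f) = 0.
  by apply: h' => // g _; rewrite mulr_ge0// ltW// farea_gt0.
by rewrite mulf_eq0 gt_eqF ?farea_gt0//= => /eqP.
Qed.

Lemma space_constant_of_As_eq0 (phi : vec R Vc) : (forall m, As phi m = 0) ->
  forall k v v', phi (k, v) = phi (k, v').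
Proof.
move=> h k; apply: (constant_on_mesh hM) => f.
have E := @gradh_inj _ _ hM f (fun i => phi (k, tri f i)).
have {}E := E _; move=> i j.
have H a : \sum_i phi (k, tri f i) * gradh f a i = 0.
  by have := h ((k, f), a); rewrite ffunE.
by rewrite (E H i) (E H j).
Qed.

Lemma As_space_constant (phi : vec R Vc) :
    (forall k v v', phi (k, v) = phi (k, v')) ->
  forall m, As phi m = 0.
Proof.
move=> h [[k f] a]; rewrite ffunE /=.
transitivity (\sum_i phi (k, tri f ord0) * gradh f a i).
  by apply: eq_bigr => i _; rewrite (h k (tri f i) (tri f ord0)).
by rewrite -mulr_sumr gradh_const// mulr0.
Qed.

Lemma constant_of_time_nonincreasing (g : 'I_N.+1 -> R) :
  (forall l, g (tnext l) <= g (tprev l)) -> g ord0 <= g ord_max ->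
  forall k, g k = g ord0.
Proof.
move=> gl g0.
pose G n := g (inord n).
have mono m n : (m + n <= N)%N -> G (m + n)%N <= G m.
  elim: n => [|n ih]; first by rewrite addn0.
  rewrite addnS => mn; apply: le_trans (ih (ltnW mn)).
  have := gl (Ordinal mn); rewrite /G.
  have -> : tnext (Ordinal mn) = inord (m + n).+1.
    by apply/val_inj; rewrite /= inordK.
  by have -> : tprev (Ordinal mn) = inord (m + n) by apply/val_inj;
    rewrite /= inordK// ltnW.
have Gk k : g k = G k by rewrite /G inord_val.
move=> k; apply/eqP; rewrite eq_le; apply/andP; split.
  by rewrite Gk (Gk ord0); apply: (mono 0%N); rewrite add0n -ltnS.
apply: (le_trans g0); rewrite Gk (Gk k).
have := mono k (N - k)%N; rewrite subnKC; last by rewrite -ltnS.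
by apply.
Qed.

(** The constant 1 is the invariant direction, pinned by the value at one
    vertex at time 0; the Slater point is minus the time index, with zero
    gradient and time derivative - N. *)
Lemma KKT_dot_exists (mu0 muN : vec R 'I_(nV M)) (c : vec R Vc) :
  \sum_v varea v * mu0 v = 1 -> \sum_v varea v * muN v = 1 ->
  (forall phi : vec R Vc, dot_cV phi c =
     \sum_v varea v * phi (ord0, v) * mu0 v
     - \sum_v varea v * phi (ord_max, v) * muN v) ->
  exists phi lam0 lamb, KKT_dot c phi (opA phi) lam0 lamb (- lam0).
Proof.
move=> m0 mN hc.
have [v0 _] : exists v0 : 'I_(nV M), True.
  have [v _|h] := pickP (@predT 'I_(nV M)); first by exists v.
  move/eqP: m0; rewrite big1 => [|v _]; first by rewrite eq_sym oner_eq0.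
  by have := h v.
pose u : vec R Vc := [ffun=> 1].
pose xs : vec R Vc := [ffun s : Vc => - (nat_of_ord s.1)%:R].
pose w (p : Vst) (m : Tc3) : R := 2^-1 * Lt (Ls_adj (unitv R m.1)) p.
have quadE p (phi : vec R Vc) : quad (fun m phi => As phi m) w p phi =
    2^-1 * Lt (Ls_adj (face_dot (As phi) (As phi))) p.
  rewrite -Lt_Ls_adj_face_dot mulr_sumr; apply: eq_bigr => m _.
  by rewrite /w -mulrA expr2.
have consE p (phi : vec R Vc) :
    constraint (fun p phi => At phi p) (fun m phi => As phi m) w p phi =
        dot_g (opA phi) p.
  by rewrite /constraint quadE dot_gE /opA topv_stack botv_stack.
have dconsE p (phi d : vec R Vc) :
    dconstraint (fun p phi => At phi p) (fun m phi => As phi m) w p phi d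
    = dot_dg (opA phi) (opA d) p.
  rewrite /dconstraint [RHS]ffunE /opA !topv_stack !botv_stack; congr (_ + _).
  rewrite -Lt_Ls_adj_face_dot mulr_sumr; apply: eq_bigr => m _.
  by rewrite /w; field.
have w0 p m : 0 <= w p m.
  by rewrite mulr_ge0// Lt_Ls_adj_ge0// => t; rewrite ffunE ler0n.
have const_cost k0 kN (phi : vec R Vc) : (forall v, phi (ord0, v) = k0 phi) ->
    (forall v, phi (ord_max, v) = kN phi) -> dot_cV phi c = k0 phi - kN phi.
  move=> h0 hN'; rewrite hc.
  under eq_bigr do rewrite h0 mulrAC.
  under [X in _ - X]eq_bigr do rewrite hN' mulrAC.
  by rewrite -!mulr_suml m0 mN !mul1r.
(* The gradient of d vanishes, so that d depends on time only; At d <= 0 and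
   d_0 - d_N <= 0 then make it constant. *)
have rec d : dot_cV d c <= 0 -> (forall p, At d p <= 0) ->
    (forall p, quad (fun m phi => As phi m) w p d = 0) ->
    d (ord0, v0) = 0 -> d = 0.
  move=> cd ad qd ed.
  have Fd : forall t, face_dot (As d) (As d) t = 0.
    apply: Lt_Ls_adj_eq0 => [t|p]; first exact: face_dot_ge0.
    have := qd p; rewrite quadE => /eqP; rewrite mulf_eq0 invr_eq0 pnatr_eq0/=.
    by move/eqP.
  have Ad m : As d m = 0.
    case: m => t a; have := Fd t; rewrite ffunE => h.
    have := psumr_eq0P _ h; move/(_ _)/(_ a isT)/eqP;
      rewrite mulf_eq0 orbb => h'.
    by apply/eqP/h' => i _; rewrite -expr2 sqr_ge0.
  have dconst := space_constant_of_As_eq0 Ad.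
  have c0 := const_cost (fun d => d (ord0, v0)) (fun d => d (ord_max, v0)) d
    (fun v => dconst _ _ _) (fun v => dconst _ _ _).
  have T := @constant_of_time_nonincreasing (fun k => d (k, v0)).
  apply/ffunP => -[k v]; rewrite [RHS]ffunE (dconst k v v0) T//.
    move=> l; have := ad (l, v0); rewrite ffunE /= pmulr_rle0// subr_le0.
    by [].
  by move: cd; rewrite c0 subr_le0.
have uA p : At u p = 0 by rewrite !ffunE subrr mulr0.
have uS m : As u m = 0 by apply: As_space_constant => *; rewrite !ffunE.
have xA p : At xs p = - N%:R.
  by rewrite !ffunE /= /bump /= add1n -natr1; ring.
have xS m : As xs m = 0 by apply: As_space_constant => *; rewrite !ffunE.
have slater p :
    constraint (fun p phi => At phi p) (fun m phi => As phi m) w p xs < 0.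
  rewrite /constraint xA /quad big1 => [|m _]; last by rewrite xS expr0n mulr0.
  by rewrite addr0 oppr_lt0.
have lin_c : linear_form (fun phi => dot_cV phi c) by exact: linear_form_dotp.
have lin_e : linear_form (fun phi : vec R Vc => phi (ord0, v0)).
  by move=> x d t; rewrite ffunE.
have uc : dot_cV u c = 0.
  by rewrite (const_cost (fun=> 1) (fun=> 1)) ?subrr// => v; rewrite ffunE.
have ue : u (ord0, v0) = 1 by rewrite ffunE.
have [phi [lam [lam0 lamg lamc st]]] := convex_program_KKT lin_c lin_e
  (@linear_map_At R M N) (@linear_map_As R M N) w0 rec uc uA uS ue slater.
pose mu : vec R Vst := [ffun p => lam p / (varea p.2 / N%:R)].
have muE p : WstV mu p = lam p.
  by rewrite !ffunE mulrC divfK// gt_eqF// weight_gt0.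
exists phi, mu, (botv (momentum (opA phi) mu)); split => //.
- have -> : stack mu (botv (momentum (opA phi) mu)) = momentum (opA phi) mu.
    by rewrite /momentum botv_stack.
  apply/stationary_phi => d.
  rewrite (dotp_Wq_momentum hM hN) -[RHS](st d); congr (_ + _).
  by apply: eq_bigr => p _; rewrite muE dconsE mulrC.
- by rewrite subrr.
- split => [p| |p]; last by rewrite -consE.
    by rewrite ffunE divr_ge0// ltW// weight_gt0.
  by rewrite /dotp big1// => p _; rewrite -consE [mu p]ffunE mulrAC lamc mul0r.
- by rewrite /momentum botv_stack.
Qed.

End KKTSystems.

Theorem theorem4p5 (R : realType) (M : mesh_data R) (N : nat)
  (hM : is_mesh M) (hN : (0 < N)%N)
  (mu0 muN : vec R 'I_(nV M))
  (mu0_ge0 : forall v, 0 <= mu0 v) (muN_ge0 : forall v, 0 <= muN v)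
  (mu0_mass : \sum_v varea v * mu0 v = 1)
  (muN_mass : \sum_v varea v * muN v = 1)
  (c : vec R (Vc M N))
  (hc : forall phi : vec R (Vc M N),
     dot_cV phi c = \sum_v varea v * phi (ord0, v) * mu0 v
                    - \sum_v varea v * phi (ord_max, v) * muN v) :
  [/\ exists phi q z alpha beta, KKT_soc c phi q z alpha beta,
      forall phi q z alpha beta, KKT_soc c phi q z alpha beta ->
        KKT_dot c phi q (topv alpha) (botv alpha) (- topv alpha)
    & forall phi q lam0 lamb lamq,
        KKT_dot c phi q lam0 lamb lamq <->
        dot_KKT_point c phi q (stack lam0 lamb) (- lamq)].
Proof.
split.
- have [phi [lam0 [lamb h]]] := KKT_dot_exists hM hN mu0_mass muN_mass hc.
  by exists phi, (opA phi); exact: KKT_soc_of_dot h.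
- by move=> phi q z alpha beta; exact: KKT_dot_of_soc.
- by move=> phi q lam0 lamb lamq; exact: KKT_dot_lagrangian.
Qed.
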